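(* Fix $\alpha\in(0,1]$ and $\delta>0$. Consider the symmetric two-user IM/DD interference channel with $h_{11}=h_{22}=1$, $h_{12}=h_{21}=g$, $\alpha_1=\alpha_2=\alpha$, where the cross gain is tied to the peak-to-noise ratio by $g=\left(\frac{\mathsf{A}}{\sigma}\right)^{\delta-1}$ (equivalently $\delta=\frac{\log(g\mathsf{A}/\sigma)}{\log(\mathsf{A}/\sigma)}$). Define the generalized degrees of freedom $$\gamma(\delta)=\lim_{\frac{\mathsf{A}}{\sigma}\to\infty}\frac{\mathsf{C}_{\rm sum}}{2\log\left(\frac{\mathsf{A}}{\sigma}\right)}.$$ Then $$\gamma(\delta)=\min\Big\{\max\{1-\delta,\delta\},\ \max\{1-\tfrac{\delta}{2},\tfrac{\delta}{2}\},\ 1\Big\}.$$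
   Context: Two-user IM/DD interference channel: for $i,j\in\{1,2\}$, $i\neq j$, at each time instant $Y_i=h_{ii}X_i+h_{ji}X_j+Z_i$, where $h_{kl}\ge 0$ are channel gains, the noises $Z_1,Z_2$ are $\mathcal{N}(0,\sigma^2)$ ($\sigma>0$), i.i.d. over time and independent of the inputs. Each input must satisfy $X_i\in[0,\mathsf{A}]$ (peak constraint, $\mathsf{A}>0$) and $\mathbb{E}[X_i]\le\alpha_i\mathsf{A}$ with $\alpha_i\in(0,1]$. Transmitter $i$ encodes a message $m_i\in\{1,\dots,\lceil 2^{n\mathsf{R}_i}\rceil\}$ into a length-$n$ codeword whose symbols satisfy these constraints; receiver $i$ decodes $m_i$ from $Y_i^n$. A rate pair $(\mathsf{R}_1,\mathsf{R}_2)$ is achievable if there exist codes whose average error probabilities at both receivers tend to $0$ as $n\to\infty$. The capacity region $\mathcal{G}$ is the closure of the set of achievable rate pairs, and $\mathsf{C}_{\rm sum}=\max_{(\mathsf{R}_1,\mathsf{R}_2)\in\mathcal{G}}(\mathsf{R}_1+\mathsf{R}_2)$. All logarithms are base 2. *)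

(* Defs.v *)
From HB Require Import structures.
From mathcomp Require Import all_boot all_order all_algebra.
From mathcomp Require Import all_classical all_reals all_analysis.
Set Implicit Arguments. Unset Strict Implicit. Unset Printing Implicit Defensive.
Import Order.TTheory GRing.Theory Num.Theory.
Import numFieldNormedType.Exports.
Local Open Scope classical_set_scope.
Local Open Scope ring_scope.

Definition log2 {R : realType} (x : R) : R := ln x / ln 2.

(* Expectation of f(Z^n) where Z^n is i.i.d. N(0, s^2) (s = standard deviation),
   defined as the iterated integral against the one-dimensional Gaussian
   probability measure [normal_prob 0 s] (the n-fold product measure). *)
Fixpoint gauss_int {R : realType} (s : R) (n : nat) :
    (n.-tuple R -> \bar R) -> \bar R :=
  match n return (n.-tuple R -> \bar R) -> \bar R with
  | 0 => fun f => f [tuple]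
  | n'.+1 => fun f =>
      (\int[normal_prob 0 s]_z gauss_int s (fun t : n'.-tuple R => f (cons_tuple z t)))%E
  end.

Definition msg_size {R : realType} (n : nat) (r : R) : nat :=
  `|Num.ceil (2 `^ (n%:R * r))|%N.

Record code (R : realType) (n M1 M2 : nat) := Code {
  enc1 : 'I_M1 -> n.-tuple R;
  enc2 : 'I_M2 -> n.-tuple R;
  dec1 : n.-tuple R -> 'I_M1;
  dec2 : n.-tuple R -> 'I_M2 }.

Definition input_ok {R : realType} (A a : R) (n : nat) (x : n.-tuple R) : Prop :=
  (forall t : 'I_n, 0 <= tnth x t <= A) /\
  \sum_(t < n) tnth x t <= a * A * n%:R.

Definition valid_code {R : realType} (A a1 a2 : R) (n M1 M2 : nat)
    (c : code R n M1 M2) : Prop :=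
  (forall m, input_ok A a1 (enc1 c m)) /\ (forall m, input_ok A a2 (enc2 c m)) /\
  (forall m, measurable (dec1 c @^-1` [set m])) /\
  (forall m, measurable (dec2 c @^-1` [set m])).

Definition chan_out {R : realType} (n : nat) (h_own h_cross : R)
    (x x' z : n.-tuple R) : n.-tuple R :=
  [tuple h_own * tnth x t + h_cross * tnth x' t + tnth z t | t < n].

Definition err1 {R : realType} (h11 h21 s : R) (n M1 M2 : nat)
    (c : code R n M1 M2) : \bar R :=
  ((M1 * M2)%:R^-1)%:E *
  (\sum_(m1 < M1) \sum_(m2 < M2)
     gauss_int s (fun z => if dec1 c (chan_out h11 h21 (enc1 c m1) (enc2 c m2) z) != m1
                           then 1 else 0))%E.

Definition err2 {R : realType} (h22 h12 s : R) (n M1 M2 : nat)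
    (c : code R n M1 M2) : \bar R :=
  ((M1 * M2)%:R^-1)%:E *
  (\sum_(m1 < M1) \sum_(m2 < M2)
     gauss_int s (fun z => if dec2 c (chan_out h22 h12 (enc2 c m2) (enc1 c m1) z) != m2
                           then 1 else 0))%E.

Definition achievable {R : realType} (h11 h12 h21 h22 a1 a2 A s : R)
    (r : R * R) : Prop :=
  exists c : forall n : nat, code R n (msg_size n r.1) (msg_size n r.2),
    (forall n, valid_code A a1 a2 (c n)) /\
    (forall eps : R, 0 < eps -> exists N : nat, forall n : nat, (N <= n)%N ->
        (err1 h11 h21 s (c n) <= eps%:E)%E /\ (err2 h22 h12 s (c n) <= eps%:E)%E).

Definition cap_region {R : realType} (h11 h12 h21 h22 a1 a2 A s : R) : set (R * R) :=
  closure [set r | achievable h11 h12 h21 h22 a1 a2 A s r].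

Definition Csum {R : realType} (h11 h12 h21 h22 a1 a2 A s : R) : R :=
  sup [set r.1 + r.2 | r in cap_region h11 h12 h21 h22 a1 a2 A s].

(* Main.v *)
(* With [P = A / s] and [g = P ^ (delta - 1)], the limit follows from bounds on the sum
   rate that match up to an additive constant (converse) and up to a factor [1 - 2 ep] and
   an additive constant (achievability).

   Converse.  If [p1], [p2] are the output densities given the own message (and a genie
   signal) and [q1], [q2] are arbitrary output densities, then the expectation of
   [1(message i decoded) qi / pi] is at most [1 / Mi]; by AM-GM,
   [E [1(both decoded) sqrt (q1 q2 / (p1 p2))] <= 1 / sqrt (M1 M2)].  For a suitable genie
   the mixture densities of the interference cancel in [q1 q2 / (p1 p2)], and Gaussian
   densities of large variance in the [qi] bound that quotient below pointwise.  Three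
   choices of genie (all interference known; a Z channel; the interference caused, seen
   through the noise of the other receiver) give the three terms of the minimum.

   Achievability.  Each user sends a letter [c + v]: [v] is a private lattice point whose
   image at the other receiver lies below the noise, and [c] is taken from two finite sets
   such that both [c1 + g c2] and [g c1 + c2] separate all pairs.  Unless some noise sample
   exceeds [t s], every letter is then determined; a Gilbert-Varshamov code over this
   alphabet corrects the small fraction of times where this happens. *)
Require Import Defs.
From HB Require Import structures.
From mathcomp Require Import all_boot all_order all_algebra.
From mathcomp Require Import all_classical all_reals all_analysis.
From mathcomp Require Import measurable_realfun ring lra zify.
Set Implicit Arguments. Unset Strict Implicit. Unset Printing Implicit Defensive.
Import Order.TTheory GRing.Theory Num.Theory.
Import numFieldNormedType.Exports.
Local Open Scope classical_set_scope.
Local Open Scope ring_scope.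

(** * Iterated integrals *)

(** As [P] grows, [g] runs through all values of [P ^ (delta - 1)], so no exceptional gain may be
    discarded. A fixed pair of regular grids would fail at those [g] for which two sums [c1 + g c2]
    coincide or nearly do. Therefore only one grid is regular; the other is built for the given [g],
    by comparing the length of the forbidden set with the available range. The mean constraint costs
    a constant: letters stay in [[0, alpha A]], so every codeword satisfies it, and the loss does
    not depend on [P]. The exponents add up as follows. For [delta <= 1] a private letter takes
    about [P ^ (1 - delta)] values, and a common letter about [P ^ max (0, min (2 delta - 1, delta /
    2))]; the sum of the exponents is the claimed minimum. For [delta >= 1] the common letter alone
    carries [min (1, delta / 2)]. The noise threshold [t] depends on [ep] only and stays fixed while
    [P] grows; [ep] is sent to 0 last. *)

Section iterated_integral.
Local Open Scope ereal_scope.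
Context d (T : measurableType d) (R : realType).
Variable mu : {sigma_finite_measure set T -> \bar R}.

(** The recursion of [gauss_int] over an arbitrary sigma-finite measure: Gaussian expectations and
    Lebesgue integrals over words obey one set of rules, and no product measure has to be built. *)
Fixpoint pint (n : nat) : (n.-tuple T -> \bar R) -> \bar R :=
  match n return (n.-tuple T -> \bar R) -> \bar R with
  | 0 => fun f => f [tuple]
  | n'.+1 => fun f => \int[mu]_z pint (fun t : n'.-tuple T => f (cons_tuple z t))
  end.

Lemma pint_ge0 n (f : n.-tuple T -> \bar R) : (forall t, 0 <= f t) -> 0 <= pint f.
Proof.
elim: n f => [|n IH] f f0 /=; first exact: f0.
by apply: integral_ge0 => z _; apply: IH => t; exact: f0.
Qed.

Lemma measurable_cons_tuple n :
  measurable_fun [set: T * n.-tuple T] (fun p => cons_tuple p.1 p.2).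
Proof. exact: (measurable_cons measurable_fst measurable_snd). Qed.

Lemma measurable_cons_tuple2 n (z : T) :
  measurable_fun [set: n.-tuple T] (fun p => cons_tuple z p).
Proof. exact: (measurable_cons (measurable_cst z) (@measurable_id _ _ _)). Qed.

(** The parameter space [T'] is arbitrary because the induction enlarges it: the first letter of the
    word joins the parameter before Tonelli integrates it out. *)
Lemma measurable_pint n d' (T' : measurableType d') (F : T' * n.-tuple T -> \bar R) :
  measurable_fun [set: T' * n.-tuple T] F -> (forall x, 0 <= F x) ->
  measurable_fun setT (fun t' => pint (fun x => F (t', x))).
Proof.
elim: n d' T' F => [|n IH] d' T' F mF F0 /=.
  by apply: (measurableT_comp mF); exact: measurable_fun_pair.
have mG : measurable_fun [set: (T' * T) * n.-tuple T]
    (fun p => F (p.1.1, cons_tuple p.1.2 p.2)).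
  apply: (measurableT_comp mF); apply: measurable_fun_pair.
    exact: (measurableT_comp measurable_fst measurable_fst).
  apply: (measurable_cons _ measurable_snd).
  exact: (measurableT_comp measurable_snd measurable_fst).
have mH := IH _ _ _ mG (fun x => F0 _).
have := @measurable_fun_fubini_tonelli_F _ _ T' T R mu _ mH.
by apply => x; apply: pint_ge0 => t; exact: F0.
Qed.

Lemma measurable_pint_cons n (f : n.+1.-tuple T -> \bar R) :
  measurable_fun setT f -> (forall x, 0 <= f x) ->
  measurable_fun setT (fun z => pint (fun t : n.-tuple T => f (cons_tuple z t))).
Proof.
move=> mf f0.
apply: (@measurable_pint _ _ _ (fun p : T * n.-tuple T => f (cons_tuple p.1 p.2))) => //.
exact: (measurableT_comp mf (@measurable_cons_tuple n)).
Qed.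

Lemma eq_pint n (f g : n.-tuple T -> \bar R) : (forall t, f t = g t) -> pint f = pint g.
Proof. by move=> fg; congr pint; apply/funext. Qed.

Lemma pint_le n (f g : n.-tuple T -> \bar R) :
  measurable_fun setT f -> measurable_fun setT g ->
  (forall t, 0 <= f t) -> (forall t, f t <= g t) -> pint f <= pint g.
Proof.
elim: n f g => [|n IH] f g mf mg f0 fg /=; first exact: fg.
have g0 t : 0 <= g t := le_trans (f0 t) (fg t).
apply: ge0_le_integral => //.
- by move=> z _; apply: pint_ge0 => t; exact: f0.
- exact: measurable_pint_cons.
- exact: measurable_pint_cons.
- move=> z _; apply: IH => //.
    exact: (measurableT_comp mf (measurable_cons_tuple2 _)).
  exact: (measurableT_comp mg (measurable_cons_tuple2 _)).
Qed.

Lemma pintD n (f g : n.-tuple T -> \bar R) :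
  measurable_fun setT f -> measurable_fun setT g ->
  (forall t, 0 <= f t) -> (forall t, 0 <= g t) ->
  pint (fun t => f t + g t) = pint f + pint g.
Proof.
elim: n f g => [|n IH] f g mf mg f0 g0 //=.
rewrite -ge0_integralD//.
- apply: eq_integral => z _; apply: IH => //.
    exact: (measurableT_comp mf (measurable_cons_tuple2 _)).
  exact: (measurableT_comp mg (measurable_cons_tuple2 _)).
- by move=> z _; apply: pint_ge0 => t; exact: f0.
- exact: measurable_pint_cons.
- by move=> z _; apply: pint_ge0 => t; exact: g0.
- exact: measurable_pint_cons.
Qed.

Lemma pintZ n (k : R) (f : n.-tuple T -> \bar R) :
  measurable_fun setT f -> (forall t, 0 <= f t) -> (0 <= k)%R ->
  pint (fun t => k%:E * f t) = k%:E * pint f.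
Proof.
elim: n f => [|n IH] f mf f0 k0 //=.
rewrite -ge0_integralZl//.
- apply: eq_integral => z _; apply: IH => //.
  exact: (measurableT_comp mf (measurable_cons_tuple2 _)).
- exact: measurable_pint_cons.
- by move=> z _; apply: pint_ge0 => t; exact: f0.
Qed.

Lemma pint_sum n (I : Type) (s : seq I) (F : I -> n.-tuple T -> \bar R) :
  (forall i, measurable_fun setT (F i)) -> (forall i t, 0 <= F i t) ->
  pint (fun t => \sum_(i <- s) F i t) = \sum_(i <- s) pint (F i).
Proof.
move=> mF F0; elim: s => [|i s IH].
  rewrite big_nil; under eq_pint do rewrite big_nil.
  transitivity (pint (fun t : n.-tuple T => 0%:E * 0)).
    by apply: eq_pint => t; rewrite mule0.
  by rewrite pintZ// mul0e.
rewrite big_cons -IH -pintD//.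
- by apply: eq_pint => t; rewrite big_cons.
- exact: emeasurable_sum.
- by move=> t; apply: sume_ge0.
Qed.

Lemma pint_prod n (w : T -> R) : measurable_fun setT w -> (forall z, (0 <= w z)%R) ->
  pint (fun t : n.-tuple T => (\prod_(i < n) w (tnth t i))%:E) =
  (\int[mu]_z (w z)%:E) ^+ n.
Proof.
move=> mw w0; elim: n => [|n IH] /=; first by rewrite big_ord0.
have mp m : measurable_fun [set: m.-tuple T] (fun t => (\prod_(i < m) w (tnth t i))%R).
  apply: measurable_prod => i _; apply: (measurableT_comp mw); exact: measurable_tnth.
have -> : (fun z => pint (fun t : n.-tuple T =>
      (\prod_(i < n.+1) w (tnth (cons_tuple z t) i))%:E)) =
    (fun z => (w z)%:E * (\int[mu]_z (w z)%:E) ^+ n).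
  apply/funext => z; rewrite -IH -pintZ//.
  - apply: eq_pint => t; rewrite big_ord_recl EFinM tnth0.
    by under eq_bigr do rewrite tnthS.
  - by apply/measurable_EFinP; exact: mp.
  - by move=> t; rewrite lee_fin prodr_ge0.
rewrite /= ge0_integralZr//.
- by case: (n) => [|n1]; rewrite ?mule1.
- exact/measurable_EFinP.
- by move=> z _; rewrite lee_fin.
- by apply: expe_ge0; apply: integral_ge0 => z _; rewrite lee_fin.
Qed.

Lemma pint_integral_swap n d' (T' : measurableType d')
    (nu : {sigma_finite_measure set T' -> \bar R}) (F : T' * n.-tuple T -> \bar R) :
  measurable_fun [set: T' * n.-tuple T] F -> (forall x, 0 <= F x) ->
  \int[nu]_y pint (fun x => F (y, x)) = pint (fun x => \int[nu]_y F (y, x)).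
Proof.
elim: n F => [|n IH] F mF F0 //=.
have mG : measurable_fun [set: (T' * T) * n.-tuple T]
    (fun p => F (p.1.1, cons_tuple p.1.2 p.2)).
  apply: (measurableT_comp mF); apply: measurable_fun_pair.
    exact: (measurableT_comp measurable_fst measurable_fst).
  apply: (measurable_cons _ measurable_snd).
  exact: (measurableT_comp measurable_snd measurable_fst).
have mH := measurable_pint mG (fun x => F0 _).
have -> := @fubini_tonelli _ _ _ _ R nu mu _ mH (fun p => pint_ge0 (fun t => F0 _)).
apply: eq_integral => z _.
apply: (IH (fun p => F (p.1, cons_tuple z p.2))) => //.
apply: (measurableT_comp mF); apply: measurable_fun_pair => //.
exact: (measurableT_comp (measurable_cons_tuple2 z) measurable_snd).
Qed.

End iterated_integral.

Lemma pint_swap (R : realType) d1 d2 (T1 : measurableType d1) (T2 : measurableType d2)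
    (mu1 : {sigma_finite_measure set T1 -> \bar R})
    (mu2 : {sigma_finite_measure set T2 -> \bar R}) n m
    (F : n.-tuple T1 * m.-tuple T2 -> \bar R) :
  measurable_fun [set: n.-tuple T1 * m.-tuple T2] F -> (forall x, 0 <= F x)%E ->
  pint mu1 (fun x => pint mu2 (fun y => F (x, y))) =
  pint mu2 (fun y => pint mu1 (fun x => F (x, y))).
Proof.
elim: n F => [|n IH] F mF F0 //=.
under eq_integral => z _.
  rewrite (IH (fun p => F (cons_tuple z p.1, p.2))) //; last first.
    apply: (measurableT_comp mF); apply: measurable_fun_pair => //.
    exact: (measurableT_comp (measurable_cons_tuple2 z) measurable_fst).
  over.
rewrite /= (@pint_integral_swap _ _ _ _ _ _ _ _
  (fun p : T1 * m.-tuple T2 => pint mu1 (fun x : n.-tuple T1 => F (cons_tuple p.1 x, p.2))))//.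
- apply: (@measurable_pint _ _ _ _ _ _ _
    (fun q : (T1 * m.-tuple T2) * n.-tuple T1 => F (cons_tuple q.1.1 q.2, q.1.2))) => //.
  apply: (measurableT_comp mF); apply: measurable_fun_pair.
    apply: (measurable_cons _ measurable_snd).
    exact: (measurableT_comp measurable_fst measurable_fst).
  exact: (measurableT_comp measurable_snd measurable_fst).
- by move=> x; apply: pint_ge0.
Qed.

(** * Translation invariance of the Lebesgue integral over words *)

Section lebesgue_translation.
Context {R : realType}.
Local Notation leb := (@lebesgue_measure R).
Local Open Scope ereal_scope.

Lemma lebesgue_measure_shift (a : R) (A : set R) : measurable A ->
  pushforward leb ((fun z => a + z)%R : measurableTypeR R -> measurableTypeR R) A = leb A.
Proof.
move=> mA.
have mf : measurable_fun setT ((fun z => a + z)%R : measurableTypeR R -> measurableTypeR R).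
  exact: measurable_funD.
apply/esym/(lebesgue_measure_unique (mu := pushforward leb _)) => //= _ [[b c]] _ <-.
rewrite /pushforward.
have -> : ((fun z => a + z)%R @^-1` `]b, c])%classic = `](b - a)%R, (c - a)%R]%classic.
  by apply/seteqP; split => z /=; rewrite !in_itv/= lterBDl lterBDl.
rewrite !lebesgue_measure_itv/= !lte_fin ltrD2r.
by case: ifP => // _; congr EFin; ring.
Qed.

Lemma integral_shift (a : R) (f : R -> \bar R) :
  measurable_fun setT f -> (forall z, 0 <= f z) ->
  \int[leb]_z f (a + z)%R = \int[leb]_z f z.
Proof.
move=> mf f0.
have mg : measurable_fun setT ((fun z => a + z)%R : measurableTypeR R -> measurableTypeR R).
  exact: measurable_funD.
rewrite -[LHS](@ge0_integral_pushforward _ _ _ _ R _ mg leb setT f)//.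
by apply: eq_measure_integral => A mA _; exact: lebesgue_measure_shift.
Qed.

Definition tshift n (a t : n.-tuple R) : n.-tuple R :=
  [tuple (tnth a i + tnth t i)%R | i < n].

Lemma measurable_tshift n (a : n.-tuple R) : measurable_fun setT (tshift a).
Proof.
apply/measurable_fun_tnthP => i.
under [X in measurable_fun _ X]funext => t do rewrite /= tnth_mktuple.
by apply: measurable_funD => //; exact: measurable_tnth.
Qed.

Lemma pint_shift n (a : n.-tuple R) (f : n.-tuple R -> \bar R) :
  measurable_fun setT f -> (forall t, 0 <= f t) ->
  pint leb (fun t => f (tshift a t)) = pint leb f.
Proof.
elim: n a f => [|n IH] a f mf f0 /=.
  have H (t : 0.-tuple R) : f t = f [tuple] by rewrite (tuple0 t).
  exact: H.
pose a' : n.-tuple R := [tuple of behead a].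
pose g z := pint leb (fun t : n.-tuple R => f (cons_tuple z t)).
transitivity (\int[leb]_z g (tnth a ord0 + z)%R).
  apply: eq_integral => z _.
  rewrite /g -(IH a' (fun t => f (cons_tuple (tnth a ord0 + z)%R t)))//; last first.
    exact: (measurableT_comp mf (measurable_cons_tuple2 _)).
  apply: eq_pint => t; congr f; apply: eq_from_tnth => i.
  rewrite tnth_mktuple; have [j ->|->] := unliftP ord0 i.
    rewrite !tnthS tnth_mktuple; congr +%R.
    by rewrite [in LHS](tuple_eta a) tnthS.
  by rewrite !tnth0.
apply: integral_shift; last by move=> z; exact: pint_ge0.
rewrite /g; exact: (@measurable_pint_cons _ (measurableTypeR R) R leb n f mf f0).
Qed.

End lebesgue_translation.

(** * Gaussian expectations as Lebesgue integrals against a density *)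

Section gaussian_density.
Context {R : realType} (s : R).
Local Notation leb := (@lebesgue_measure R).
Local Open Scope ereal_scope.

(** The Radon-Nikodym derivative of [normal_prob] and the function [normal_pdf] have the same
    integral over every measurable set, hence agree almost everywhere. *)
Lemma integral_normal_prob (f : R -> \bar R) :
  measurable_fun setT f -> (forall z, 0 <= f z) ->
  \int[normal_prob 0 s]_z f z = \int[leb]_z (f z * (normal_pdf 0 s z)%:E).
Proof.
move=> mf f0.
have dom := @normal_prob_dominates R 0%R s.
rewrite -(Radon_Nikodym_SigmaFinite.change_of_variables dom)//.
apply: ae_eq_integral => //.
- apply: emeasurable_funM => //.
  exact: (measurable_int leb (Radon_Nikodym_SigmaFinite.f_integrable dom)).
- apply: emeasurable_funM => //=; apply/measurable_EFinP.
  exact: measurable_normal_pdf.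
apply: ae_eqe_mul2l; apply: integral_ae_eq => //.
- exact: Radon_Nikodym_SigmaFinite.f_integrable.
- by apply/measurable_EFinP; exact: measurable_normal_pdf.
- by move=> E _ mE; rewrite -Radon_Nikodym_SigmaFinite.f_integral.
Qed.

Lemma gauss_intE n (f : n.-tuple R -> \bar R) : gauss_int s f = pint (normal_prob 0 s) f.
Proof.
by elim: n f => [|n IH] f //=; apply: eq_integral => z _; rewrite IH.
Qed.

Definition pdfn n (L : R) (t : n.-tuple R) : R := (\prod_(i < n) normal_pdf 0 L (tnth t i))%R.

Lemma pdfn_ge0 n L (t : n.-tuple R) : (0 <= pdfn L t)%R.
Proof. by apply: prodr_ge0 => i _; exact: normal_pdf_ge0. Qed.

Lemma measurable_pdfn n L : measurable_fun [set: n.-tuple R] (@pdfn n L).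
Proof.
apply: measurable_prod => i _.
by apply: (measurableT_comp (measurable_normal_pdf _ _)); exact: measurable_tnth.
Qed.

Lemma pint_pdfn n L : pint leb (fun t : n.-tuple R => (pdfn L t)%:E) = 1.
Proof.
rewrite /pdfn pint_prod//.
- rewrite integral_normal_pdf; elim: n => // n IH; case: n IH => // n IH.
  by rewrite expeS IH mule1.
- exact: measurable_normal_pdf.
- by move=> z; exact: normal_pdf_ge0.
Qed.

Lemma pint_normal n (f : n.-tuple R -> \bar R) :
  measurable_fun setT f -> (forall t, 0 <= f t) ->
  pint (normal_prob 0 s) f = pint leb (fun t => f t * (pdfn s t)%:E).
Proof.
elim: n f => [|n IH] f mf f0 /=; first by rewrite /pdfn big_ord0 mule1.
rewrite integral_normal_prob; last 2 first.
  exact: (@measurable_pint_cons _ (measurableTypeR R) R (normal_prob 0 s) n f mf f0).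
- by move=> z; exact: pint_ge0.
apply: eq_integral => z _.
rewrite IH//; last exact: (measurableT_comp mf (measurable_cons_tuple2 _)).
rewrite muleC -pintZ; last 3 first.
- apply: emeasurable_funM; first exact: (measurableT_comp mf (measurable_cons_tuple2 _)).
  by apply/measurable_EFinP; exact: measurable_pdfn.
- by move=> t; rewrite mule_ge0// lee_fin pdfn_ge0.
- exact: normal_pdf_ge0.
apply: eq_pint => t; rewrite muleCA; congr (_ * _).
rewrite /pdfn big_ord_recl tnth0 -EFinM.
by under [in RHS]eq_bigr do rewrite tnthS.
Qed.

End gaussian_density.

(** * Integrals over one noise word and over a pair of noise words *)

Section lint.
Context {R : realType}.
Local Notation leb := (@lebesgue_measure R).
Local Open Scope ereal_scope.

Definition lint n (f : n.-tuple R -> \bar R) : \bar R := pint leb f.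

Lemma lint_ge0 n (f : n.-tuple R -> \bar R) : (forall t, 0 <= f t) -> 0 <= lint f.
Proof. exact: (@pint_ge0 _ (measurableTypeR R) R leb). Qed.

Lemma eq_lint n (f g : n.-tuple R -> \bar R) : (forall t, f t = g t) -> lint f = lint g.
Proof. exact: (@eq_pint _ (measurableTypeR R)). Qed.

Lemma measurable_lint n d' (T' : measurableType d') (F : T' * n.-tuple R -> \bar R) :
  measurable_fun [set: T' * n.-tuple R] F -> (forall x, 0 <= F x) ->
  measurable_fun setT (fun t' => lint (fun x => F (t', x))).
Proof. exact: (@measurable_pint _ (measurableTypeR R)). Qed.

Lemma lint_le n (f g : n.-tuple R -> \bar R) :
  measurable_fun setT f -> measurable_fun setT g ->
  (forall t, 0 <= f t) -> (forall t, f t <= g t) -> lint f <= lint g.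
Proof. exact: (@pint_le _ (measurableTypeR R)). Qed.

Lemma lintD n (f g : n.-tuple R -> \bar R) :
  measurable_fun setT f -> measurable_fun setT g ->
  (forall t, 0 <= f t) -> (forall t, 0 <= g t) ->
  lint (fun t => f t + g t) = lint f + lint g.
Proof. exact: (@pintD _ (measurableTypeR R)). Qed.

Lemma lintZ n (k : R) (f : n.-tuple R -> \bar R) :
  measurable_fun setT f -> (forall t, 0 <= f t) -> (0 <= k)%R ->
  lint (fun t => k%:E * f t) = k%:E * lint f.
Proof. exact: (@pintZ _ (measurableTypeR R)). Qed.

Lemma lint_sum n (I : Type) (s : seq I) (F : I -> n.-tuple R -> \bar R) :
  (forall i, measurable_fun setT (F i)) -> (forall i t, 0 <= F i t) ->
  lint (fun t => \sum_(i <- s) F i t) = \sum_(i <- s) lint (F i).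
Proof. exact: (@pint_sum _ (measurableTypeR R)). Qed.

Lemma lint_swap n m (F : n.-tuple R * m.-tuple R -> \bar R) :
  measurable_fun [set: n.-tuple R * m.-tuple R] F -> (forall x, 0 <= F x) ->
  lint (fun x => lint (fun y => F (x, y))) = lint (fun y => lint (fun x => F (x, y))).
Proof. exact: (@pint_swap R _ _ (measurableTypeR R) (measurableTypeR R)). Qed.

Lemma lint_shift n (a : n.-tuple R) (f : n.-tuple R -> \bar R) :
  measurable_fun setT f -> (forall t, 0 <= f t) ->
  lint (fun t => f (tshift a t)) = lint f.
Proof. exact: pint_shift. Qed.

Lemma lint_pdfn n L : lint (fun t : n.-tuple R => (pdfn L t)%:E) = 1.
Proof. exact: pint_pdfn. Qed.

Lemma gauss_int_lint s n (f : n.-tuple R -> \bar R) :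
  measurable_fun setT f -> (forall t, 0 <= f t) ->
  gauss_int s f = lint (fun t => f t * (pdfn s t)%:E).
Proof. by move=> mf f0; rewrite gauss_intE pint_normal. Qed.

(** [x] is the noise word of receiver 1 and [y] that of receiver 2. Each error probability involves
    only one of them, so the converse is free to couple them independently. *)
Definition dint n (F : n.-tuple R * n.-tuple R -> R) : \bar R :=
  lint (fun x => lint (fun y => (F (x, y))%:E)).

Section dint.
Variable n : nat.
Local Notation X := (n.-tuple R).
Implicit Types F G : X * X -> R.

Lemma dint_ge0 F : (forall x, 0 <= F x)%R -> 0 <= dint F.
Proof. by move=> F0; do 2! (apply: lint_ge0 => ?); rewrite lee_fin. Qed.

Lemma eq_dint F G : (forall x, F x = G x) -> dint F = dint G.
Proof. by move=> FG; congr dint; apply/funext. Qed.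

Lemma measurable_sec F x : measurable_fun [set: X * X] F ->
  measurable_fun setT (fun y : X => (F (x, y))%:E).
Proof.
move=> mF; apply/measurable_EFinP.
by apply: (measurableT_comp mF); exact: measurable_fun_pair.
Qed.

Lemma measurable_inner F : measurable_fun [set: X * X] F -> (forall x, 0 <= F x)%R ->
  measurable_fun setT (fun x : X => lint (fun y => (F (x, y))%:E)).
Proof.
move=> mF F0; apply: (measurable_lint (F := fun p => (F p)%:E)).
  exact/measurable_EFinP.
by move=> x; rewrite lee_fin.
Qed.

Lemma dint_le F G : measurable_fun [set: X * X] F -> measurable_fun [set: X * X] G ->
  (forall x, 0 <= F x)%R -> (forall x, F x <= G x)%R -> dint F <= dint G.
Proof.
move=> mF mG F0 FG; have G0 x : (0 <= G x)%R := le_trans (F0 x) (FG x).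
apply: lint_le; try exact: measurable_inner.
- by move=> x; apply: lint_ge0 => y; rewrite lee_fin.
- move=> x; apply: lint_le; try exact: measurable_sec.
    by move=> y; rewrite lee_fin.
  by move=> y; rewrite lee_fin.
Qed.

Lemma dintD F G : measurable_fun [set: X * X] F -> measurable_fun [set: X * X] G ->
  (forall x, 0 <= F x)%R -> (forall x, 0 <= G x)%R ->
  dint (fun p => F p + G p)%R = dint F + dint G.
Proof.
move=> mF mG F0 G0; rewrite /dint -lintD; try exact: measurable_inner.
- apply: eq_lint => x; rewrite -lintD; try exact: measurable_sec.
  + by apply: eq_lint => y; rewrite EFinD.
  + by move=> y; rewrite lee_fin.
  + by move=> y; rewrite lee_fin.
- by move=> x; apply: lint_ge0 => y; rewrite lee_fin.
- by move=> x; apply: lint_ge0 => y; rewrite lee_fin.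
Qed.

Lemma dintZ (k : R) F : measurable_fun [set: X * X] F -> (forall x, 0 <= F x)%R ->
  (0 <= k)%R -> dint (fun p => k * F p)%R = k%:E * dint F.
Proof.
move=> mF F0 k0; rewrite /dint -lintZ//; last 2 first.
- exact: measurable_inner.
- by move=> x; apply: lint_ge0 => y; rewrite lee_fin.
apply: eq_lint => x; rewrite -lintZ//; first exact: measurable_sec.
by move=> y; rewrite lee_fin.
Qed.

Lemma dint_sum (I : Type) (r : seq I) (F : I -> X * X -> R) :
  (forall i, measurable_fun [set: X * X] (F i)) -> (forall i x, 0 <= F i x)%R ->
  dint (fun p => \sum_(i <- r) F i p)%R = \sum_(i <- r) dint (F i).
Proof.
move=> mF F0; elim: r => [|i r IH].
  rewrite big_nil; transitivity (dint (fun p : X * X => 0 * 0)%R).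
    by apply: eq_dint => x; rewrite big_nil mulr0.
  by rewrite dintZ// mul0e.
rewrite big_cons -IH -dintD//.
- by apply: eq_dint => x; rewrite big_cons.
- exact: measurable_sum.
- by move=> x; apply: sumr_ge0.
Qed.

Lemma dint_swap F : measurable_fun [set: X * X] F -> (forall x, 0 <= F x)%R ->
  dint (fun p => F (p.2, p.1)) = dint F.
Proof.
move=> mF F0; rewrite /dint [RHS](lint_swap (F := fun p => (F p)%:E))//.
exact/measurable_EFinP.
Qed.

Lemma dint_shift (a b : X) F : measurable_fun [set: X * X] F ->
  (forall x, 0 <= F x)%R ->
  dint (fun p => F (tshift a p.1, tshift b p.2)) = dint F.
Proof.
move=> mF F0; rewrite /dint /=.
rewrite -[RHS](lint_shift a); last 2 first.
- exact: measurable_inner.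
- by move=> x; apply: lint_ge0 => y; rewrite lee_fin.
apply: eq_lint => x; rewrite (lint_shift b (f := fun y => (F (tshift a x, y))%:E))//.
- exact: measurable_sec.
- by move=> y; rewrite lee_fin.
Qed.

Lemma dint_fst (f : X -> R) L : measurable_fun setT f -> (forall x, 0 <= f x)%R ->
  dint (fun p => f p.1 * pdfn L p.2)%R = lint (fun x => (f x)%:E).
Proof.
move=> mf f0; apply: eq_lint => x /=.
rewrite -[RHS]mule1 -(lint_pdfn n L) -lintZ//.
- by apply/measurable_EFinP; exact: measurable_pdfn.
- by move=> y; rewrite lee_fin pdfn_ge0.
Qed.

Lemma dint_snd (f : X -> R) L : measurable_fun setT f -> (forall x, 0 <= f x)%R ->
  dint (fun p => f p.2 * pdfn L p.1)%R = lint (fun x => (f x)%:E).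
Proof.
move=> mf f0; rewrite -(dint_fst L mf f0).
apply: (dint_swap (F := fun p => (f p.1 * pdfn L p.2)%R)).
  apply: measurable_funM; first exact: (measurableT_comp mf).
  exact: (measurableT_comp (@measurable_pdfn _ _ _)).
by move=> x; rewrite mulr_ge0 ?pdfn_ge0.
Qed.

End dint.
End lint.

(** * Converse *)

(* AM-GM in place of Cauchy-Schwarz keeps everything linear in the integrands. *)
Lemma amgm_bound {R : realType} (K l f w1 w2 : R) : 0 <= K -> 0 < l -> 0 <= w1 -> 0 <= w2 ->
  0 <= f -> f ^+ 2 <= K ^+ 2 * (w1 * w2) -> f <= K / 2 * l * w1 + K / 2 * l^-1 * w2.
Proof.
move=> K0 l0 w10 w20 f0 H.
have -> : K / 2 * l * w1 + K / 2 * l^-1 * w2 = K * ((l * w1 + l^-1 * w2) / 2).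
  by field; exact: lt0r_neq0.
rewrite -(ler_pXn2r (n := 2)) ?nnegrE//; last first.
  by rewrite mulr_ge0// divr_ge0// addr_ge0// mulr_ge0// ?invr_ge0 ltW.
apply: (le_trans H); rewrite exprMn ler_wpM2l ?sqr_ge0//.
have -> : w1 * w2 = (l * w1) * (l^-1 * w2) by field; exact: lt0r_neq0.
set a := l * w1; set b := l^-1 * w2.
have : 0 <= (a - b) ^+ 2 by rewrite sqr_ge0.
nra.
Qed.

Lemma measurable_natr_negb d (T : measurableType d) (R : realType) (b : T -> bool) :
  measurable_fun setT (fun z => (b z)%:R : R) ->
  measurable_fun setT (fun z => (~~ b z)%:R : R).
Proof.
move=> mb; rewrite (_ : (fun z => _) = (fun z => 1 - (b z)%:R)).
  exact: measurable_funB.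
by apply/funext => z; case: (b z); rewrite ?subrr ?subr0.
Qed.

(** * Combining the weighted decoding bounds of the two receivers *)

Section two_receivers.
Context {R : realType} (s : R) (n M1 M2 : nat).
Local Notation X := (n.-tuple R).
Variables (c1 c2 : 'I_M1 -> 'I_M2 -> X -> bool) (w1 w2 : 'I_M1 -> 'I_M2 -> X * X -> R).
Hypothesis M1_gt0 : (0 < M1)%N.
Hypothesis M2_gt0 : (0 < M2)%N.
Hypothesis mc1 : forall i j, measurable_fun setT (fun z => (c1 i j z)%:R : R).
Hypothesis mc2 : forall i j, measurable_fun setT (fun z => (c2 i j z)%:R : R).
Hypothesis mw1 : forall i j, measurable_fun [set: X * X] (w1 i j).
Hypothesis mw2 : forall i j, measurable_fun [set: X * X] (w2 i j).
Hypothesis w1_ge0 : forall i j p, 0 <= w1 i j p.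
Hypothesis w2_ge0 : forall i j p, 0 <= w2 i j p.

(** For each message pair the mass 1 of the noise density is split according to which receivers
    decode correctly. Where both do, AM-GM bounds the density by the weights, whose sums over all
    messages are controlled; elsewhere one of the error terms covers it. *)
Lemma two_receiver_bound (K e1 e2 : R) : 0 <= K ->
  (forall i j p, (pdfn s p.1 * pdfn s p.2) ^+ 2 <= K ^+ 2 * (w1 i j p * w2 i j p)) ->
  (\sum_(i < M1) \sum_(j < M2) dint (fun p => ((c1 i j p.1)%:R * w1 i j p)%R) <= M2%:R%:E)%E ->
  (\sum_(i < M1) \sum_(j < M2) dint (fun p => ((c2 i j p.2)%:R * w2 i j p)%R) <= M1%:R%:E)%E ->
  (\sum_(i < M1) \sum_(j < M2) lint (fun z => ((~~ c1 i j z)%:R * pdfn s z)%:E)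
     <= ((M1 * M2)%:R * e1)%:E)%E ->
  (\sum_(i < M1) \sum_(j < M2) lint (fun z => ((~~ c2 i j z)%:R * pdfn s z)%:E)
     <= ((M1 * M2)%:R * e2)%:E)%E ->
  (M1 * M2)%:R * (1 - e1 - e2) <= K * Num.sqrt (M1 * M2)%:R.
Proof.
move=> K0 Hw S1 S2 E1 E2.
have M1r : 0 < M1%:R :> R by rewrite ltr0n.
have M2r : 0 < M2%:R :> R by rewrite ltr0n.
(* This [l] balances AM-GM: after summation both weights contribute [K / 2] times the square root of
   [M1 * M2]. *)
pose l : R := Num.sqrt (M1 * M2)%:R / M2%:R.
have r0 : 0 < Num.sqrt (M1 * M2)%:R :> R by rewrite sqrtr_gt0 ltr0n muln_gt0 M1_gt0.
have l0 : 0 < l by rewrite divr_gt0.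
pose F1 i j (p : X * X) : R := (c1 i j p.1)%:R * w1 i j p.
pose F2 i j (p : X * X) : R := (c2 i j p.2)%:R * w2 i j p.
pose G1 i j (p : X * X) : R := (~~ c1 i j p.1)%:R * pdfn s p.1 * pdfn s p.2.
pose G2 i j (p : X * X) : R := (~~ c2 i j p.2)%:R * pdfn s p.2 * pdfn s p.1.
have mP (k : X * X -> X) : measurable_fun setT k ->
    measurable_fun [set: X * X] (fun p => pdfn s (k p)).
  by move=> mk; apply: (measurableT_comp (@measurable_pdfn R n s)).
have mF1 i j : measurable_fun setT (F1 i j).
  by apply: measurable_funM => //; exact: (measurableT_comp (mc1 i j)).
have mF2 i j : measurable_fun setT (F2 i j).
  by apply: measurable_funM => //; exact: (measurableT_comp (mc2 i j)).
have mG1 i j : measurable_fun setT (G1 i j).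
  apply: measurable_funM; last exact: mP.
  apply: measurable_funM; last exact: mP.
  exact: (measurableT_comp (measurable_natr_negb (mc1 i j))).
have mG2 i j : measurable_fun setT (G2 i j).
  apply: measurable_funM; last exact: mP.
  apply: measurable_funM; last exact: mP.
  exact: (measurableT_comp (measurable_natr_negb (mc2 i j))).
have F10 i j p : 0 <= F1 i j p by rewrite mulr_ge0.
have F20 i j p : 0 <= F2 i j p by rewrite mulr_ge0.
have G10 i j p : 0 <= G1 i j p by rewrite !mulr_ge0 ?pdfn_ge0.
have G20 i j p : 0 <= G2 i j p by rewrite !mulr_ge0 ?pdfn_ge0.
have H i j : (1 <= (K / 2 * l)%:E * dint (F1 i j) + (K / 2 * l^-1)%:E * dint (F2 i j) +
    lint (fun z => ((~~ c1 i j z)%:R * pdfn s z)%:E) +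
    lint (fun z => ((~~ c2 i j z)%:R * pdfn s z)%:E))%E.
  have k1 : 0 <= K / 2 * l by rewrite !mulr_ge0// ?invr_ge0// ltW.
  have k2 : 0 <= K / 2 * l^-1 by rewrite !mulr_ge0// ?invr_ge0// ltW.
  rewrite -(dint_fst s (f := fun z => (~~ c1 i j z)%:R * pdfn s z)); last 2 first.
  - apply: measurable_funM; last exact: measurable_pdfn.
    exact: measurable_natr_negb.
  - by move=> x; rewrite mulr_ge0 ?pdfn_ge0.
  rewrite -(dint_snd s (f := fun z => (~~ c2 i j z)%:R * pdfn s z)); last 2 first.
  - apply: measurable_funM; last exact: measurable_pdfn.
    exact: measurable_natr_negb.
  - by move=> x; rewrite mulr_ge0 ?pdfn_ge0.
  have m1 : measurable_fun setT (fun p => K / 2 * l * F1 i j p) by exact: measurable_funM.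
  have m2 : measurable_fun setT (fun p => K / 2 * l^-1 * F2 i j p) by exact: measurable_funM.
  have m12 := measurable_funD m1 m2.
  have m123 := measurable_funD m12 (mG1 i j).
  have p1 p : 0 <= K / 2 * l * F1 i j p by rewrite mulr_ge0.
  have p2 p : 0 <= K / 2 * l^-1 * F2 i j p by rewrite mulr_ge0.
  have p12 p := addr_ge0 (p1 p) (p2 p).
  have p123 p := addr_ge0 (p12 p) (G10 i j p).
  rewrite -(dintZ (mF1 i j))// -(dintZ (mF2 i j))//.
  rewrite -(dintD m1 m2)// -(dintD m12 (mG1 i j))// -(dintD m123 (mG2 i j))//.
  apply: (@le_trans _ _ (dint (fun p : X * X => pdfn s p.1 * pdfn s p.2))).
    rewrite (dint_fst s (f := pdfn s)) ?lint_pdfn//; first exact: measurable_pdfn.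
    exact: pdfn_ge0.
  apply: dint_le.
  - by apply: measurable_funM; exact: mP.
  - exact: measurable_funD m123 (mG2 i j).
  - by move=> p; rewrite mulr_ge0 ?pdfn_ge0.
  move=> p; rewrite /F1 /F2 /G1 /G2 /=.
  have P1 := pdfn_ge0 s p.1; have P2 := pdfn_ge0 s p.2.
  have P12 := mulr_ge0 P1 P2.
  have w1p := w1_ge0 i j p; have w2p := w2_ge0 i j p.
  have A := amgm_bound K0 l0 w1p w2p P12 (Hw i j p).
  have B1 := mulr_ge0 k1 w1p; have B2 := mulr_ge0 k2 w2p.
  by case: (c1 i j p.1); case: (c2 i j p.2); rewrite /= ?mul1r ?mul0r ?mulr0; lra.
have HS : (\sum_(i < M1) \sum_(j < M2) 1 <=
    \sum_(i < M1) \sum_(j < M2) ((K / 2 * l)%:E * dint (F1 i j) +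
    (K / 2 * l^-1)%:E * dint (F2 i j) +
    lint (fun z => ((~~ c1 i j z)%:R * pdfn s z)%:E) +
    lint (fun z => ((~~ c2 i j z)%:R * pdfn s z)%:E)))%E.
  by apply: lee_sum => i _; apply: lee_sum => j _; exact: H.
move: HS.
under [X in (_ <= X)%E -> _]eq_bigr do rewrite !big_split/=.
rewrite !big_split/=.
under [X in (_ <= X + _ + _ + _)%E -> _]eq_bigr => i _.
  rewrite -ge0_sume_distrr; last by move=> j _; exact: dint_ge0.
  over.
rewrite -ge0_sume_distrr; last by move=> i _; apply: sume_ge0 => j _; exact: dint_ge0.
under [X in (_ <= _ + X + _ + _)%E -> _]eq_bigr => i _.
  rewrite -ge0_sume_distrr; last by move=> j _; exact: dint_ge0.
  over.
rewrite -ge0_sume_distrr; last by move=> i _; apply: sume_ge0 => j _; exact: dint_ge0.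
move=> HS.
have {HS} : (\sum_(i < M1) \sum_(j < M2) 1 <=
    (K / 2 * l)%:E * M2%:R%:E + (K / 2 * l^-1)%:E * M1%:R%:E +
    ((M1 * M2)%:R * e1)%:E + ((M1 * M2)%:R * e2)%:E)%E.
  apply: (le_trans HS); apply: leeD => //; apply: leeD => //; apply: leeD => //.
    by apply: lee_wpmul2l => //; rewrite lee_fin !mulr_ge0// ?invr_ge0// ltW.
  by apply: lee_wpmul2l => //; rewrite lee_fin !mulr_ge0// ?invr_ge0// ltW.
rewrite -!EFinM -!EFinD.
have -> : (\sum_(i < M1) \sum_(j < M2) 1 = (M1 * M2)%:R%:E :> \bar R)%E.
  under eq_bigr do rewrite sumEFin.
  by rewrite sumEFin !big_const_ord !iter_addr_0 -mulrnA mulnC.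
rewrite lee_fin.
have -> : K / 2 * l * M2%:R = K * Num.sqrt (M1 * M2)%:R / 2.
  by rewrite /l; field; exact: lt0r_neq0.
have -> : K / 2 * l^-1 * M1%:R = K * Num.sqrt (M1 * M2)%:R / 2.
  rewrite /l invf_div.
  have E : Num.sqrt (M1 * M2)%:R * Num.sqrt (M1 * M2)%:R = M1%:R * M2%:R :> R.
    by rewrite -expr2 sqr_sqrtr ?ler0n// natrM.
  rewrite -[RHS]mulrA -[LHS]mulrA; apply: (mulfI (lt0r_neq0 r0)).
  transitivity (K / 2 * (M1%:R * M2%:R)); first by field; exact: lt0r_neq0.
  by rewrite -E; field.
lra.
Qed.

End two_receivers.

(** * Shifted Gaussian densities, their mixtures, and auxiliary joint densities *)

Section shifted_densities.
Context {R : realType}.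

Definition tscale n (g : R) (x : n.-tuple R) : n.-tuple R := [tuple g * tnth x i | i < n].

Lemma tshiftC n (a b z : n.-tuple R) : tshift a (tshift b z) = tshift b (tshift a z).
Proof. by apply: eq_from_tnth => i; rewrite !tnth_mktuple addrCA. Qed.

Definition dens n (L : R) (c u : n.-tuple R) : R :=
  \prod_(i < n) normal_pdf 0 L (tnth u i - tnth c i).

Lemma normal_pdf_gt0 (L : R) x : L != 0 -> 0 < normal_pdf 0 L x.
Proof. by move=> L0; rewrite normal_pdfE// mulr_gt0 ?expR_gt0 ?normal_peak_gt0. Qed.

Lemma dens_gt0 n L (c u : n.-tuple R) : L != 0 -> 0 < dens L c u.
Proof. by move=> L0; apply: prodr_gt0 => i _; exact: normal_pdf_gt0. Qed.

Lemma dens_ge0 n L (c u : n.-tuple R) : 0 <= dens L c u.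
Proof. by apply: prodr_ge0 => i _; exact: normal_pdf_ge0. Qed.

Lemma dens_shift n L (c z : n.-tuple R) : dens L c (tshift c z) = pdfn L z.
Proof. by apply: eq_bigr => i _; rewrite tnth_mktuple addrAC subrr add0r. Qed.

Lemma measurable_dens_comp n L d (T : measurableType d) (f h : T -> n.-tuple R) :
  measurable_fun setT f -> measurable_fun setT h ->
  measurable_fun setT (fun x => dens L (f x) (h x)).
Proof.
move=> mf mh; apply: measurable_prod => i _.
apply: (measurableT_comp (measurable_normal_pdf _ _)).
by apply: measurable_funB; exact: (measurableT_comp (measurable_tnth i)).
Qed.

Lemma measurable_tscale n g : measurable_fun setT (@tscale n g).
Proof.
apply/measurable_fun_tnthP => i.
under [X in measurable_fun _ X]funext => t do rewrite /= tnth_mktuple.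
by apply: measurable_funM => //; exact: measurable_tnth.
Qed.

Lemma lint_dens n L (c : n.-tuple R) : lint (fun u => (dens L c u)%:E) = 1%E.
Proof.
rewrite -(lint_shift c) /=.
- by under eq_lint do rewrite dens_shift; rewrite lint_pdfn.
- by apply/measurable_EFinP; apply: measurable_dens_comp => //; exact: measurable_cst.
- by move=> t; rewrite lee_fin dens_ge0.
Qed.

(** With the scaled codewords of the interferer as [c], this is the density of interference plus
    noise under a uniform message. *)
Definition avgd n L M (c : 'I_M -> n.-tuple R) (u : n.-tuple R) : R :=
  M%:R^-1 * \sum_(m < M) dens L (c m) u.

Lemma avgd_ge0 n L M (c : 'I_M -> n.-tuple R) u : 0 <= avgd L c u.
Proof. by rewrite mulr_ge0// sumr_ge0// => i _; exact: dens_ge0. Qed.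

Lemma avgd_gt0 n L M (c : 'I_M -> n.-tuple R) u : L != 0 -> (0 < M)%N -> 0 < avgd L c u.
Proof.
move=> L0 M0; rewrite mulr_gt0// ?invr_gt0 ?ltr0n//.
rewrite (bigD1 (Ordinal M0))//= ltr_wpDr ?dens_gt0//.
by apply: sumr_ge0 => i _; exact: dens_ge0.
Qed.

Lemma measurable_avgd n L M (c : 'I_M -> n.-tuple R) : measurable_fun setT (avgd L c).
Proof.
apply: measurable_funM => //; apply: measurable_sum => m.
by apply: measurable_dens_comp => //; exact: measurable_cst.
Qed.

Lemma sum_dens_avgd n L M (c : 'I_M -> n.-tuple R) u : L != 0 -> (0 < M)%N ->
  \sum_(m < M) dens L (c m) u / avgd L c u = M%:R.
Proof.
move=> L0 M0; rewrite -mulr_suml /avgd invfM invrK mulrCA divff ?mulr1//.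
have := avgd_gt0 c u L0 M0; rewrite /avgd => /lt0r_neq0.
by rewrite mulf_eq0 negb_or => /andP[].
Qed.

Lemma lint_avgd n L M (c : 'I_M -> n.-tuple R) : (0 < M)%N ->
  lint (fun u => (avgd L c u)%:E) = 1%E.
Proof.
move=> M0; rewrite /avgd; under eq_lint do rewrite EFinM -sumEFin.
have m1 i : measurable_fun setT (fun u : n.-tuple R => (dens L (c i) u)%:E).
  by apply/measurable_EFinP; apply: measurable_dens_comp => //; exact: measurable_cst.
rewrite lintZ//.
- rewrite lint_sum//; last by move=> i t; rewrite lee_fin dens_ge0.
  under eq_bigr do rewrite lint_dens.
  rewrite sumEFin big_const_ord iter_addr_0 -EFinM mulVf// pnatr_eq0.
  by rewrite -lt0n.
- exact: emeasurable_sum.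
- by move=> t; apply: sume_ge0 => i _; rewrite lee_fin dens_ge0.
Qed.

(** An auxiliary joint density of an output [p.1] and a genie signal [p.2]: the signal has density
    [f], and given the signal the output is Gaussian around [k] times it. With [k = 0] and
    [f = pdfn s] the second coordinate is a mere dummy noise. *)
Definition kern n (f : n.-tuple R -> R) (L k : R) (p : n.-tuple R * n.-tuple R) : R :=
  f p.2 * dens L (tscale k p.2) p.1.

Lemma measurable_kern n (f : n.-tuple R -> R) L k : measurable_fun setT f ->
  measurable_fun [set: n.-tuple R * n.-tuple R] (kern f L k).
Proof.
move=> mf; apply: measurable_funM; first exact: (measurableT_comp mf).
apply: measurable_dens_comp => //.
exact: (measurableT_comp (@measurable_tscale n k)).
Qed.

Lemma kern_ge0 n (f : n.-tuple R -> R) L k p : (forall u, 0 <= f u) -> 0 <= kern f L k p.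
Proof. by move=> f0; rewrite mulr_ge0 ?dens_ge0. Qed.

Lemma dint_kern n (f : n.-tuple R -> R) L k : measurable_fun setT f ->
  (forall u, 0 <= f u) -> lint (fun u => (f u)%:E) = 1%E -> dint (kern f L k) = 1%E.
Proof.
move=> mf f0 f1; rewrite -dint_swap; last 2 first.
- exact: measurable_kern.
- by move=> x; exact: kern_ge0.
rewrite -f1; apply: eq_lint => v; rewrite /kern /=.
under eq_lint do rewrite EFinM.
rewrite lintZ//; first by rewrite lint_dens mule1.
- by apply/measurable_EFinP; apply: measurable_dens_comp => //; exact: measurable_cst.
- by move=> u; rewrite lee_fin dens_ge0.
Qed.

End shifted_densities.

(** * Change of measure at one receiver *)

Section receiver.
Context {R : realType} (n M M' : nat).
Local Notation X := (n.-tuple R).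
Variables (dec : X -> 'I_M) (x : 'I_M -> X) (t : 'I_M' -> X) (c : 'I_M -> X).
Variable H : X * X -> R.
Hypothesis mdec : forall m, measurable (dec @^-1` [set m]).
Hypothesis mH : measurable_fun [set: X * X] H.
Hypothesis H_ge0 : forall p, 0 <= H p.
Hypothesis H_le1 : (dint H <= 1)%E.

Lemma measurable_dec_comp d (T : measurableType d) (f : T -> X) i :
  measurable_fun setT f -> measurable_fun setT (fun z => (dec (f z) == i)%:R : R).
Proof.
move=> mf; apply: (measurableT_comp (f := fun z => (dec z == i)%:R : R)) => //.
rewrite (_ : (fun z => _) = \1_(dec @^-1` [set i])); first exact: measurable_indic.
apply/funext => z; rewrite indicE; congr (nat_of_bool _)%:R.
by apply/eqP/idP; rewrite inE.
Qed.

(** The decision regions of a decoder partition the space. *)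
Let sum_dec (k : X -> X) : measurable_fun setT k ->
  (\sum_(i < M) dint (fun p => ((dec (k p.1) == i)%:R * H p)%R) <= 1)%E.
Proof.
move=> mk; rewrite -dint_sum.
- apply: le_trans H_le1; rewrite le_eqVlt; apply/orP; left; apply/eqP/eq_dint => p.
  rewrite -mulr_suml (bigD1 (dec (k p.1)))//= eqxx big1 ?addr0 ?mul1r// => i.
  by rewrite eq_sym => /negbTE ->.
- move=> i; apply: measurable_funM => //.
  by apply: (measurable_dec_comp (f := fun p : X * X => k p.1)); exact: (measurableT_comp mk).
- by move=> i p; rewrite mulr_ge0.
Qed.

(* [H] is the auxiliary density [q] of a receiver that knows the interfering codeword. *)
Lemma receiver_known_interference :
  (\sum_(i < M) \sum_(j < M') dint (fun p => ((dec (tshift (x i) (tshift (t j) p.1)) == i)%:R *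
     H (tshift (x i) p.1, tshift (c i) p.2))%R) <= M'%:R%:E)%E.
Proof.
rewrite exchange_big /=.
apply: (@le_trans _ _ (\sum_(j < M') 1)%E); last first.
  by rewrite sumEFin big_const_ord iter_addr_0.
(* For a fixed interfering word, translation by [x i] and [c i] turns the summands into integrals of
   one function [H] over disjoint decision regions. *)
apply: lee_sum => j _.
apply: le_trans (sum_dec (measurable_tshift (t j))).
apply: lee_sum => i _.
rewrite -[leRHS](dint_shift (x i) (c i)); last 2 first.
- apply: measurable_funM => //.
  apply: (measurable_dec_comp (f := fun p : X * X => tshift (t j) p.1)).
  exact: (measurableT_comp (measurable_tshift _)).
- by move=> p; rewrite mulr_ge0.
by rewrite le_eqVlt; apply/orP; left; apply/eqP/eq_dint => p; rewrite tshiftC.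
Qed.

(* The factor [avgd] in the denominator is the mixture density of the interference, which
   the genie signal of the other user supplies in the numerator. *)
Lemma receiver_unknown_interference s : s != 0 -> (0 < M')%N ->
  (\sum_(i < M) \sum_(j < M') dint (fun p => ((dec (tshift (x i) (tshift (t j) p.1)) == i)%:R *
     (pdfn s p.1 / avgd s t (tshift (t j) p.1) *
      H (tshift (x i) (tshift (t j) p.1), tshift (c i) p.2)))%R) <= M'%:R%:E)%E.
Proof.
move=> s0 M'0.
pose G i j (p : X * X) : R := (dec (tshift (x i) p.1) == i)%:R *
  (dens s (t j) p.1 / avgd s t p.1 * H (tshift (x i) p.1, p.2)).
have avg0 u : 0 < avgd s t u by exact: avgd_gt0.
have mX i : measurable_fun setT (fun p : X * X => tshift (x i) p.1).
  exact: (measurableT_comp (measurable_tshift _)).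
have mavg : measurable_fun setT (fun u => (avgd s t u)^-1).
  rewrite (_ : (fun u => _) = (fun u => expR (- ln (avgd s t u)))); last first.
    by apply/funext => u; rewrite expRN lnK// posrE.
  apply: (measurableT_comp (@measurable_expR R)).
  apply: measurableT_comp => //; apply: (measurableT_comp (@measurable_ln R)).
  exact: measurable_avgd.
have mG i j : measurable_fun setT (G i j).
  apply: measurable_funM; first exact: measurable_dec_comp.
  apply: measurable_funM; last first.
    by apply: (measurableT_comp mH); exact: measurable_fun_pair.
  apply: measurable_funM; last exact: (measurableT_comp mavg).
  by apply: measurable_dens_comp => //; exact: measurable_cst.
have G0 i j p : 0 <= G i j p by rewrite !mulr_ge0// ?dens_ge0// invr_ge0 ltW.
(* Translation by [t j] turns the noise density into the density around [t j]; summed over [j] these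
   reproduce [M'] times the mixture in the denominator. *)
have E i j : dint (fun p => ((dec (tshift (x i) (tshift (t j) p.1)) == i)%:R *
     (pdfn s p.1 / avgd s t (tshift (t j) p.1) *
      H (tshift (x i) (tshift (t j) p.1), tshift (c i) p.2)))%R) = dint (G i j).
  rewrite -[RHS](dint_shift (t j) (c i))//; apply: eq_dint => p.
  by rewrite /G /= dens_shift.
under eq_bigr => i _ do under eq_bigr => j _ do rewrite E.
have E2 i : (\sum_(j < M') dint (G i j) =
    M'%:R%:E * dint (fun p => ((dec p.1 == i)%:R * H p)%R))%E.
  have m1 : measurable_fun setT (fun p : X * X => (dec p.1 == i)%:R * H p).
    by apply: measurable_funM => //; exact: measurable_dec_comp.
  rewrite -dint_sum// -dintZ//; last by move=> p; rewrite mulr_ge0.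
  (* [tscale 0 (x i)] is the zero word: only the first coordinate is translated. *)
  rewrite -[RHS](dint_shift (x i) (tscale 0 (x i))); last 2 first.
  - exact: measurable_funM.
  - by move=> p; rewrite !mulr_ge0.
  apply: eq_dint => p; rewrite /G /= -mulr_sumr -mulr_suml sum_dens_avgd// mulrCA.
  congr (_ * (_ * H (_, _))); apply: eq_from_tnth => k.
  by rewrite !tnth_mktuple mul0r add0r.
under eq_bigr do rewrite E2.
rewrite -ge0_sume_distrr; last first.
  by move=> i _; apply: dint_ge0 => p; rewrite mulr_ge0.
rewrite -[leRHS]mule1; apply: lee_wpmul2l => //.
exact: (sum_dec (@measurable_id _ _ setT)).
Qed.

End receiver.

(** * Pointwise comparison of Gaussian densities of different variances *)

Section gaussian_comparison.
Context {R : realType}.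

Lemma normal_pdf_scale (s L y : R) : 0 < s -> 0 < L ->
  normal_pdf 0 (s * L) y = normal_peak s / L * expR (- (y / L) ^+ 2 / (s ^+ 2 *+ 2)).
Proof.
move=> s0 L0; rewrite normal_pdfE ?mulf_neq0 ?gt_eqF//.
have -> : normal_peak (s * L) = normal_peak s / L.
  rewrite /normal_peak -invfM.
  have -> : (s * L) ^+ 2 * pi *+ 2 = (s ^+ 2 * pi *+ 2) * L ^+ 2.
    by rewrite mulrnAl exprMn mulrAC.
  rewrite sqrtrM; last by rewrite mulrn_wge0// mulr_ge0 ?sqr_ge0 ?pi_ge0.
  by rewrite sqrtr_sqr gtr0_norm.
rewrite /normal_fun subr0; congr (_ * expR _).
by rewrite -(mulr_natr (s ^+ 2)) -(mulr_natr ((s * L) ^+ 2)); field; rewrite !gt_eqF.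
Qed.

(** [L1 * L2] is the ratio of the peaks. The slack [2 * s ^+ 2], which will absorb the bounded
    inputs, becomes 1 in the exponent after division by twice the variance, hence the factor
    [expR 1]. *)
Lemma normal_pdf2_le (s L1 L2 z1 z2 y1 y2 : R) : 0 < s -> 0 < L1 -> 0 < L2 ->
  (y1 / L1) ^+ 2 + (y2 / L2) ^+ 2 <= z1 ^+ 2 + z2 ^+ 2 + 2 * s ^+ 2 ->
  normal_pdf 0 s z1 * normal_pdf 0 s z2 <=
  expR 1 * L1 * L2 * (normal_pdf 0 (s * L1) y1 * normal_pdf 0 (s * L2) y2).
Proof.
move=> s0 L10 L20 H.
have E z : normal_pdf 0 s z = normal_peak s * expR (- z ^+ 2 / (s ^+ 2 *+ 2)).
  by rewrite -{1}(mulr1 s) normal_pdf_scale// !divr1.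
rewrite !E !normal_pdf_scale//.
set p := normal_peak s.
have -> : p * expR (- z1 ^+ 2 / (s ^+ 2 *+ 2)) * (p * expR (- z2 ^+ 2 / (s ^+ 2 *+ 2))) =
    p * p * expR (- (z1 ^+ 2 + z2 ^+ 2) / (s ^+ 2 *+ 2)).
  by rewrite opprD mulrDl expRD; ring.
have -> : expR 1 * L1 * L2 * (p / L1 * expR (- (y1 / L1) ^+ 2 / (s ^+ 2 *+ 2)) *
    (p / L2 * expR (- (y2 / L2) ^+ 2 / (s ^+ 2 *+ 2)))) =
    p * p * expR (1 - ((y1 / L1) ^+ 2 + (y2 / L2) ^+ 2) / (s ^+ 2 *+ 2)).
  rewrite expRD mulrDl opprD expRD -!mulNr; field.
  by rewrite !gt_eqF.
rewrite ler_wpM2l ?mulr_ge0 ?normal_peak_ge0// ler_expR.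
have s2 : 0 < s ^+ 2 *+ 2 by rewrite pmulrn_lgt0// exprn_gt0.
rewrite -subr_ge0.
have -> : 1 - ((y1 / L1) ^+ 2 + (y2 / L2) ^+ 2) / (s ^+ 2 *+ 2) -
    - (z1 ^+ 2 + z2 ^+ 2) / (s ^+ 2 *+ 2) =
    (z1 ^+ 2 + z2 ^+ 2 + 2 * s ^+ 2 - ((y1 / L1) ^+ 2 + (y2 / L2) ^+ 2)) / (s ^+ 2 *+ 2).
  by rewrite -(mulr_natr (s ^+ 2)); field; rewrite !gt_eqF.
by rewrite divr_ge0 ?subr_ge0// ltW.
Qed.

Lemma pdfn2_le n (s L1 L2 : R) (z1 z2 u1 v1 u2 v2 : n.-tuple R) : 0 < s -> 0 < L1 -> 0 < L2 ->
  (forall i, ((tnth u1 i - tnth v1 i) / L1) ^+ 2 + ((tnth u2 i - tnth v2 i) / L2) ^+ 2 <=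
     tnth z1 i ^+ 2 + tnth z2 i ^+ 2 + 2 * s ^+ 2) ->
  pdfn s z1 * pdfn s z2 <=
  (expR 1 * L1 * L2) ^+ n * (dens (s * L1) v1 u1 * dens (s * L2) v2 u2).
Proof.
move=> s0 L10 L20 H.
have -> : (expR 1 * L1 * L2) ^+ n = \prod_(i < n) (expR 1 * L1 * L2).
  by rewrite prodr_const card_ord.
rewrite /pdfn /dens -!big_split/=.
apply: ler_prod => i _; rewrite mulr_ge0 ?normal_pdf_ge0//=.
exact: normal_pdf2_le.
Qed.

Lemma sq_div_le (y L Y : R) : 0 < L -> y ^+ 2 <= L ^+ 2 * Y -> (y / L) ^+ 2 <= Y.
Proof.
move=> L0 H; rewrite expr_div_n ler_pdivrMr ?exprn_gt0// mulrC.
exact: H.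
Qed.

Lemma sq_ltmul (L a b : R) : 0 <= a -> 0 <= b -> a <= L * b -> 0 <= L -> a ^+ 2 <= L ^+ 2 * b ^+ 2.
Proof. by move=> a0 b0 H L0; rewrite -exprMn ler_pXn2r ?nnegrE ?mulr_ge0. Qed.

End gaussian_comparison.

Section code_bounds.
Context {R : realType} (A a1 a2 s g : R) (n M1 M2 : nat) (c : Defs.code R n M1 M2).
Hypothesis s0 : 0 < s.
Hypothesis g0 : 0 < g.
Hypothesis M10 : (0 < M1)%N.
Hypothesis M20 : (0 < M2)%N.
Hypothesis cv : valid_code A a1 a2 c.
Variables (e1 e2 : R).
Hypothesis e12 : e1 + e2 <= 1.
Hypothesis E1 : (err1 1 g s c <= e1%:E)%E.
Hypothesis E2 : (err2 1 g s c <= e2%:E)%E.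
Local Notation X := (n.-tuple R).

Let x1 := enc1 c.
Let x2 := enc2 c.
Let t1 i := tscale g (x1 i).
Let t2 j := tscale g (x2 j).

Lemma chan_out_tshift (x x' z : X) :
  chan_out 1 g x x' z = tshift x (tshift (tscale g x') z).
Proof. by apply: eq_from_tnth => i; rewrite !tnth_mktuple mul1r addrA. Qed.

(** [w2] takes the noise of receiver 2 first, hence the swap [(p.2, p.1)]; the lemmas on one
    receiver then serve both users. [B] is the square of the [K] of [two_receiver_bound], and
    squaring that bound leaves one factor [M1 * M2] to cancel. *)
Lemma code_bound_gen (B : R) (w1 w2 : 'I_M1 -> 'I_M2 -> X * X -> R) : 0 <= B ->
  (forall i j, measurable_fun [set: X * X] (w1 i j)) ->
  (forall i j, measurable_fun [set: X * X] (w2 i j)) ->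
  (forall i j p, 0 <= w1 i j p) -> (forall i j p, 0 <= w2 i j p) ->
  (forall i j p, (pdfn s p.1 * pdfn s p.2) ^+ 2 <= B * (w1 i j p * w2 i j (p.2, p.1))) ->
  (\sum_(i < M1) \sum_(j < M2) dint (fun p =>
     ((dec1 c (tshift (x1 i) (tshift (t2 j) p.1)) == i)%:R * w1 i j p)%R) <= M2%:R%:E)%E ->
  (\sum_(j < M2) \sum_(i < M1) dint (fun p =>
     ((dec2 c (tshift (x2 j) (tshift (t1 i) p.1)) == j)%:R * w2 i j p)%R) <= M1%:R%:E)%E ->
  (M1 * M2)%:R * (1 - e1 - e2) ^+ 2 <= B.
Proof.
move=> B0 mw1 mw2 w10 w20 Hw S1 S2.
have [_ [_ [md1 md2]]] := cv.
have mt (a b : X) : measurable_fun setT (fun z => tshift a (tshift b z)).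
  exact: (measurableT_comp (measurable_tshift _) (measurable_tshift _)).
pose c1 i j z := dec1 c (tshift (x1 i) (tshift (t2 j) z)) == i.
pose c2 i j z := dec2 c (tshift (x2 j) (tshift (t1 i) z)) == j.
have mc1 i j : measurable_fun setT (fun z => (c1 i j z)%:R : R).
  by apply: (measurable_dec_comp md1); exact: mt.
have mc2 i j : measurable_fun setT (fun z => (c2 i j z)%:R : R).
  by apply: (measurable_dec_comp md2); exact: mt.
have mM : 0 < (M1 * M2)%:R :> R by rewrite ltr0n muln_gt0 M10.
have err (b : 'I_M1 -> 'I_M2 -> X -> bool) e :
    (forall i j, measurable_fun setT (fun z => (b i j z)%:R : R)) ->
    (((M1 * M2)%:R^-1)%:E * (\sum_(i < M1) \sum_(j < M2)
       gauss_int s (fun z => if ~~ b i j z then 1 else 0)) <= e%:E)%E ->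
    (\sum_(i < M1) \sum_(j < M2) lint (fun z => ((~~ b i j z)%:R * pdfn s z)%:E)
     <= ((M1 * M2)%:R * e)%:E)%E.
  move=> mb; rewrite lee_pdivrMl// -EFinM => Hb; apply: le_trans Hb.
  apply: lee_sum => i _; apply: lee_sum => j _.
  rewrite (_ : (fun z => if _ then _ else _) = (fun z => (~~ b i j z)%:R%:E)); last first.
    by apply/funext => z; case: (b i j z).
  rewrite gauss_int_lint//; first (apply/measurable_EFinP; apply: measurable_natr_negb; exact: mb).
have H1 := err c1 e1 mc1; have H2 := err c2 e2 mc2.
have := @two_receiver_bound R s n M1 M2 c1 c2 w1 (fun i j p => w2 i j (p.2, p.1))
  M10 M20 mc1 mc2 mw1 _ w10 _ (Num.sqrt B) e1 e2 (sqrtr_ge0 _) _ S1 _ (H1 _) (H2 _).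
have K : 0 <= Num.sqrt (M1 * M2)%:R :> R by rewrite sqrtr_ge0.
move=> H; have {H} : (M1 * M2)%:R * (1 - e1 - e2) <= Num.sqrt B * Num.sqrt (M1 * M2)%:R.
  apply: H.
  - move=> i j; apply: (measurableT_comp (mw2 i j)); exact: measurable_fun_pair.
  - by [].
  - by move=> i j p; rewrite sqr_sqrtr.
  - rewrite exchange_big /=; apply: le_trans S2.
    apply: lee_sum => j _; apply: lee_sum => i _.
    rewrite -(dint_swap (F := fun p => (c2 i j p.1)%:R * w2 i j p)) //.
    + by apply: measurable_funM => //; exact: (measurableT_comp (mc2 i j)).
    + by move=> p; rewrite mulr_ge0.
  - apply: le_trans E1; rewrite /err1 le_eqVlt; apply/orP; left; apply/eqP; congr (_ * _)%E.
    apply: eq_bigr => i _; apply: eq_bigr => j _; congr gauss_int.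
    by apply/funext => z; rewrite chan_out_tshift.
  - apply: le_trans E2; rewrite /err2 le_eqVlt; apply/orP; left; apply/eqP; congr (_ * _)%E.
    apply: eq_bigr => i _; apply: eq_bigr => j _; congr gauss_int.
    by apply/funext => z; rewrite chan_out_tshift.
move=> H.
have N0 : 0 <= (M1 * M2)%:R * (1 - e1 - e2).
  by rewrite mulr_ge0 ?ler0n//; move: e12; lra.
have : ((M1 * M2)%:R * (1 - e1 - e2)) ^+ 2 <= (Num.sqrt B * Num.sqrt (M1 * M2)%:R) ^+ 2.
  by rewrite ler_pXn2r ?nnegrE //; exact: mulr_ge0 (sqrtr_ge0 _) (sqrtr_ge0 _).
rewrite !exprMn !sqr_sqrtr ?ler0n// expr2 -mulrA mulrC.
by rewrite ler_pM2r.
Qed.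

End code_bounds.

(** * Quadratic inequalities behind the three outer bounds *)

Section comparison_inequalities.
Context {R : realType} (A s g : R).
Hypothesis s0 : 0 < s.
Hypothesis g0 : 0 < g.

(** Once the interference is removed, an output is own input plus noise. In
    [(u + v)^2 <= 2 u^2 + 2 v^2] the condition [2 <= L] pays for the noise and [2 * A <= L * s] for
    the input. *)
Lemma single_user_comparison L x y z w : 2 <= L -> 2 * A <= L * s ->
  0 <= x <= A -> 0 <= y <= A ->
  ((x + z) / L) ^+ 2 + ((y + w) / L) ^+ 2 <= z ^+ 2 + w ^+ 2 + 2 * s ^+ 2.
Proof.
move=> L2 LA /andP[x0 xA] /andP[y0 yA].
have A0 : 0 <= A := le_trans x0 xA.
have L0 : 0 < L by lra.
have LL : 4 <= L ^+ 2 by nra.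
have LsA : 4 * A ^+ 2 <= L ^+ 2 * s ^+ 2.
  have -> : 4 * A ^+ 2 = (2 * A) ^+ 2 by ring.
  by apply: sq_ltmul => //; [exact: mulr_ge0|exact: ltW s0|exact: ltW].
have bnd u v : 0 <= u <= A -> ((u + v) / L) ^+ 2 <= v ^+ 2 + s ^+ 2.
  move=> /andP[u0 uA]; apply: sq_div_le => //.
  have U : u ^+ 2 <= A ^+ 2 by nra.
  have V : 4 * v ^+ 2 <= L ^+ 2 * v ^+ 2 by rewrite ler_wpM2r ?sqr_ge0.
  have W : 0 <= (u - v) ^+ 2 by rewrite sqr_ge0.
  nra.
have B1 := bnd x z; have B2 := bnd y w.
rewrite x0 xA y0 yA in B1 B2; have {}B1 := B1 isT; have {}B2 := B2 isT.
lra.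
Qed.

(** Centring receiver 1 at the genie signal [g * x + w] divided by [g] cancels its input and leaves
    [z - w / g]. Receiver 2 has no genie, so its whole output has to fit a Gaussian of width
    [s * L2]. *)
Lemma z_comparison L1 L2 x y z w : 2 * (1 + g^-1) <= L1 -> 2 + A * (1 + g) / s <= L2 ->
  0 <= x <= A -> 0 <= y <= A ->
  ((z - w / g) / L1) ^+ 2 + ((y + g * x + w) / L2) ^+ 2 <= z ^+ 2 + w ^+ 2 + 2 * s ^+ 2.
Proof.
have sp := s0; have gp := g0; move=> HL1 HL2 /andP[x0 xA] /andP[y0 yA].
have A0 : 0 <= A := le_trans x0 xA.
have k0 : 0 < g^-1 by rewrite invr_gt0.
set k := g^-1 in HL1 k0 *.
have P0 : 0 <= A * (1 + g) / s by rewrite divr_ge0 ?(ltW s0)// mulr_ge0//; lra.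
have HL2s : A * (1 + g) <= L2 * s by rewrite -ler_pdivrMr//; lra.
have L20 : 0 < L2 by lra.
have L10 : 0 < L1 by lra.
have L22 : 4 <= L2 ^+ 2 by nra.
have L11 : 4 * (1 + k ^+ 2) <= L1 ^+ 2 by nra.
have B1 : ((z - w * k) / L1) ^+ 2 <= (z ^+ 2 + w ^+ 2) / 2.
  apply: sq_div_le => //.
  (* Cauchy-Schwarz; the square supplied next is the exact difference of the two sides. *)
  have W : (z - w * k) ^+ 2 <= (1 + k ^+ 2) * (z ^+ 2 + w ^+ 2).
    have : 0 <= (z * k + w) ^+ 2 by rewrite sqr_ge0.
    nra.
  have S : 0 <= z ^+ 2 + w ^+ 2 by rewrite addr_ge0 ?sqr_ge0.
  have : 4 * (1 + k ^+ 2) * (z ^+ 2 + w ^+ 2) <= L1 ^+ 2 * (z ^+ 2 + w ^+ 2) by rewrite ler_wpM2r.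
  have : 0 <= (1 + k ^+ 2) * (z ^+ 2 + w ^+ 2) by rewrite mulr_ge0// addr_ge0 ?sqr_ge0.
  lra.
have B2 : ((y + g * x + w) / L2) ^+ 2 <= w ^+ 2 / 2 + 2 * s ^+ 2.
  apply: sq_div_le => //.
  set u := y + g * x.
  have u0 : 0 <= u by rewrite addr_ge0// mulr_ge0// ltW.
  have uA : u <= A * (1 + g) by rewrite /u mulrDr mulr1 lerD// mulrC ler_wpM2r// ltW.
  have us : u ^+ 2 <= L2 ^+ 2 * s ^+ 2.
    by apply: sq_ltmul => //; [exact: ltW|lra|lra].
  have V : 4 * w ^+ 2 <= L2 ^+ 2 * w ^+ 2 by rewrite ler_wpM2r ?sqr_ge0.
  have W : 0 <= (u - w) ^+ 2 by rewrite sqr_ge0.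
  nra.
have : 0 <= z ^+ 2 by rewrite sqr_ge0.
lra.
Qed.

(** Subtracting the genie signal divided by [g] cancels the own input and leaves interference, own
    noise and scaled genie noise. Each receiver uses half of [z ^+ 2 + w ^+ 2] and one [s ^+ 2],
    which together exhaust the right-hand side. *)
Lemma genie_comparison L x y z w : 2 * (1 + g^-1) + 2 * g * A / s <= L ->
  0 <= x <= A -> 0 <= y <= A ->
  ((g * x + z - w / g) / L) ^+ 2 + ((g * y + w - z / g) / L) ^+ 2 <=
  z ^+ 2 + w ^+ 2 + 2 * s ^+ 2.
Proof.
have sp := s0; have gp := g0; move=> HL /andP[x0 xA] /andP[y0 yA].
have A0 : 0 <= A := le_trans x0 xA.
have k0 : 0 < g^-1 by rewrite invr_gt0.
set k := g^-1 in HL k0 *.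
have P0 : 0 <= 2 * g * A / s by rewrite divr_ge0 ?(ltW s0)// !mulr_ge0// ltW.
have HLs : 2 * (g * A) <= L * s by rewrite -ler_pdivrMr//; lra.
have L0 : 0 < L by lra.
have LL : 4 * (1 + k ^+ 2) <= L ^+ 2 by nra.
have LsA : 4 * (g * A) ^+ 2 <= L ^+ 2 * s ^+ 2.
  have -> : 4 * (g * A) ^+ 2 = (2 * (g * A)) ^+ 2 by ring.
  by apply: sq_ltmul => //; [rewrite !mulr_ge0// ltW|exact: ltW|lra].
have bnd u v t : 0 <= u <= A ->
    ((g * u + v - t * k) / L) ^+ 2 <= (v ^+ 2 + t ^+ 2) / 2 + s ^+ 2.
  move=> /andP[u0 uA]; apply: sq_div_le => //.
  have gu0 : 0 <= g * u by rewrite mulr_ge0// ltW.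
  have guA : g * u <= g * A by rewrite ler_pM2l.
  have U : (g * u) ^+ 2 <= (g * A) ^+ 2 by rewrite ler_pXn2r// nnegrE mulr_ge0// ltW.
  have W : (v - t * k) ^+ 2 <= (1 + k ^+ 2) * (v ^+ 2 + t ^+ 2).
    have : 0 <= (v * k + t) ^+ 2 by rewrite sqr_ge0.
    nra.
  have S : 0 <= v ^+ 2 + t ^+ 2 by rewrite addr_ge0 ?sqr_ge0.
  have V : 4 * (1 + k ^+ 2) * (v ^+ 2 + t ^+ 2) <= L ^+ 2 * (v ^+ 2 + t ^+ 2).
    by rewrite ler_wpM2r.
  have Z : 0 <= (g * u - (v - t * k)) ^+ 2 by rewrite sqr_ge0.
  have -> : (g * u + v - t * k) ^+ 2 = 2 * (g * u) ^+ 2 + 2 * (v - t * k) ^+ 2 -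
      (g * u - (v - t * k)) ^+ 2 by ring.
  have := sqr_ge0 (g * A); lra.
have B1 := bnd x z w; have B2 := bnd y w z.
rewrite x0 xA y0 yA in B1 B2; have {}B1 := B1 isT; have {}B2 := B2 isT.
lra.
Qed.

End comparison_inequalities.

(** * The three outer bounds for a single code *)

Section code_converse.
Context {R : realType} (A a1 a2 s g : R) (n M1 M2 : nat) (c : Defs.code R n M1 M2).
Hypothesis s0 : 0 < s.
Hypothesis g0 : 0 < g.
Hypothesis M10 : (0 < M1)%N.
Hypothesis M20 : (0 < M2)%N.
Hypothesis cv : valid_code A a1 a2 c.
Variables (e1 e2 : R).
Hypothesis e12 : e1 + e2 <= 1.
Hypothesis E1 : (err1 1 g s c <= e1%:E)%E.
Hypothesis E2 : (err2 1 g s c <= e2%:E)%E.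
Local Notation X := (n.-tuple R).

Let x1 := enc1 c.
Let x2 := enc2 c.
Let t1 i := tscale g (x1 i).
Let t2 j := tscale g (x2 j).

Let x1A i k : 0 <= tnth (x1 i) k <= A. Proof. by have [/(_ i) [] ] := cv. Qed.
Let x2A i k : 0 <= tnth (x2 i) k <= A. Proof. by have [_ [/(_ i) [] ]] := cv. Qed.
Let md1 m : measurable (dec1 c @^-1` [set m]). Proof. by have [_ [_ [+ _]]] := cv. Qed.
Let md2 m : measurable (dec2 c @^-1` [set m]). Proof. by have [_ [_ [_ +]]] := cv. Qed.

Lemma tshift_scale0 (x z : X) : tshift (tscale 0 x) z = z.
Proof. by apply: eq_from_tnth => i; rewrite !tnth_mktuple mul0r add0r. Qed.

(** In all three bounds the product [W] of the weights is, after cancellation of mixtures, the noise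
    density [P] times a product [D] of wide Gaussian densities. Comparing [P] with [D] once
    therefore bounds [P ^+ 2]. *)
Let ratio (P B D W : R) : 0 <= P -> P <= B * D -> W = P * D -> P ^+ 2 <= B * W.
Proof. by move=> P0 H ->; rewrite mulrCA expr2 ler_wpM2l. Qed.

Let pdfn2_ge0 (z1 z2 : X) : 0 <= pdfn s z1 * pdfn s z2.
Proof. by rewrite mulr_ge0 ?pdfn_ge0. Qed.

Let mshift2 (a b : X) :
  measurable_fun setT (fun p : X * X => (tshift a p.1, tshift b p.2)).
Proof.
by apply: measurable_fun_pair; exact: (measurableT_comp (measurable_tshift _)).
Qed.

Let mshift3 (a a' b : X) :
  measurable_fun setT (fun p : X * X => (tshift a (tshift a' p.1), tshift b p.2)).
Proof.
apply: measurable_fun_pair; last exact: (measurableT_comp (measurable_tshift _)).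
apply: (measurableT_comp (measurable_tshift _)).
exact: (measurableT_comp (measurable_tshift _)).
Qed.

Let mfrac M (t : 'I_M -> X) (a : X) : (0 < M)%N ->
  measurable_fun setT (fun p : X * X => pdfn s p.1 / avgd s t (tshift a p.1)).
Proof.
move=> M0; apply: measurable_funM.
  exact: (measurableT_comp (@measurable_pdfn _ _ _)).
rewrite (_ : (fun p => _) = (fun p : X * X => expR (- ln (avgd s t (tshift a p.1))))); last first.
  by apply/funext => u; rewrite expRN lnK// posrE avgd_gt0// gt_eqF.
apply: (measurableT_comp (@measurable_expR R)).
apply: measurableT_comp => //; apply: (measurableT_comp (@measurable_ln R)).
apply: (measurableT_comp (measurable_avgd _ _)).
exact: (measurableT_comp (measurable_tshift _)).
Qed.

Let frac_ge0 M (t : 'I_M -> X) (a z : X) : 0 <= pdfn s z / avgd s t (tshift a z).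
Proof. by rewrite divr_ge0 ?pdfn_ge0 ?avgd_ge0. Qed.

Let kern_pdfn_le1 L : (dint (@kern R n (pdfn s) L 0%R) <= 1)%E.
Proof.
by rewrite dint_kern ?lint_pdfn//; [exact: measurable_pdfn|exact: pdfn_ge0].
Qed.

Let kern_avgd_le1 M (t : 'I_M -> X) L k : (0 < M)%N -> (dint (kern (avgd s t) L k) <= 1)%E.
Proof.
move=> M0.
by rewrite dint_kern ?lint_avgd//; [exact: measurable_avgd|move=> u; exact: avgd_ge0].
Qed.

Let mkp L : measurable_fun setT (@kern R n (pdfn s) L 0%R).
Proof. by apply: measurable_kern; exact: measurable_pdfn. Qed.

Let mka M (t : 'I_M -> X) L k : measurable_fun setT (kern (avgd s t) L k).
Proof. by apply: measurable_kern; exact: measurable_avgd. Qed.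

Let kp0 L p : 0 <= @kern R n (pdfn s) L 0 p.
Proof. by apply: kern_ge0 => u; exact: pdfn_ge0. Qed.

Let ka0 M (t : 'I_M -> X) L k p : 0 <= kern (avgd s t) L k p.
Proof. by apply: kern_ge0 => u; exact: avgd_ge0. Qed.

Let s_neq0 : s != 0. Proof. by rewrite gt_eqF. Qed.

(** Each receiver is told the other codeword. Its dummy second coordinate is the noise of the other
    receiver, so that the two weights together contain both noise densities. *)
Lemma code_single_user_bound L : 2 <= L -> 2 * A <= L * s ->
  (M1 * M2)%:R * (1 - e1 - e2) ^+ 2 <= (expR 1 * L * L) ^+ n.
Proof.
move=> L2 LA; have L0 : 0 < L by apply: lt_le_trans L2.
apply: (@code_bound_gen R A a1 a2 s g n M1 M2 c M10 M20 cv e1 e2 e12 E1 E2 _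
  ( fun i j p => kern (pdfn s) (s * L) 0 (tshift (x1 i) p.1, tshift (tscale 0 (x1 i)) p.2))
  (fun i j p => kern (pdfn s) (s * L) 0 (tshift (x2 j) p.1, tshift (tscale 0 (x2 j)) p.2))).
- by rewrite exprn_ge0// !mulr_ge0 ?expR_ge0// ltW.
- by move=> i j; apply: (measurableT_comp (mkp _)); exact: mshift2.
- by move=> i j; apply: (measurableT_comp (mkp _)); exact: mshift2.
- by [].
- by [].
- move=> i j [z1 z2] /=; rewrite /kern /= !tshift_scale0.
  apply: ratio => //; first apply: (@pdfn2_le _ _ s L L _ _ (tshift (x1 i) z1) (tscale 0 z2)
      (tshift (x2 j) z2) (tscale 0 z1)) => //.
    move=> k; rewrite !tnth_mktuple !mul0r !subr0.
    exact: (single_user_comparison s0 _ _ L2 LA (x1A i k) (x2A j k)).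
  by rewrite mulrACA (mulrC (pdfn s z2)).
- exact: receiver_known_interference.
- exact: receiver_known_interference.
Qed.

(* Receiver 1 is told the codeword of user 2 and the signal [g x1 + z2]. *)
Lemma code_z_bound L1 L2 : 2 * (1 + g^-1) <= L1 -> 2 + A * (1 + g) / s <= L2 -> 0 <= A ->
  (M1 * M2)%:R * (1 - e1 - e2) ^+ 2 <= (expR 1 * L1 * L2) ^+ n.
Proof.
move=> HL1 HL2 A0; have k0 : 0 < g^-1 by rewrite invr_gt0.
have P0 : 0 <= A * (1 + g) / s.
  by rewrite divr_ge0 ?(ltW s0)// mulr_ge0// addr_ge0// ltW.
have L10 : 0 < L1 by lra.
have L20 : 0 < L2 by lra.
apply: (@code_bound_gen R A a1 a2 s g n M1 M2 c M10 M20 cv e1 e2 e12 E1 E2 _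
  ( fun i j p => kern (avgd s t1) (s * L1) g^-1 (tshift (x1 i) p.1, tshift (t1 i) p.2))
  (fun i j p => pdfn s p.1 / avgd s t1 (tshift (t1 i) p.1) *
     kern (pdfn s) (s * L2) 0 (tshift (x2 j) (tshift (t1 i) p.1), tshift (tscale 0 (x2 j)) p.2))).
- by rewrite exprn_ge0// !mulr_ge0 ?expR_ge0// ltW.
- by move=> i j; apply: (measurableT_comp (mka _ _ _)); exact: mshift2.
- move=> i j; apply: measurable_funM; first exact: mfrac.
  by apply: (measurableT_comp (mkp _)); exact: mshift3.
- by [].
- by move=> i j p; rewrite mulr_ge0.
- move=> i j [z1 z2] /=; rewrite /kern /= !tshift_scale0.
  apply: ratio => //; first apply: (@pdfn2_le _ _ s L1 L2 _ _ (tshift (x1 i) z1)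
      (tscale g^-1 (tshift (t1 i) z2)) (tshift (x2 j) (tshift (t1 i) z2)) (tscale 0 z1)) => //.
    move=> k; rewrite !tnth_mktuple !mul0r !subr0.
    have -> : tnth (x1 i) k + tnth z1 k - g^-1 * (g * tnth (x1 i) k + tnth z2 k) =
      tnth z1 k - tnth z2 k / g by field; rewrite gt_eqF.
    rewrite addrA; exact: (z_comparison s0 g0 _ _ HL1 HL2 (x1A i k) (x2A j k)).
  (* The mixture density of the genie signal in the first weight is the denominator of the
     second. *)
  have av := avgd_gt0 t1 (tshift (t1 i) z2) s_neq0 M10.
  by field; rewrite gt_eqF.
- by apply: receiver_known_interference => //; exact: kern_avgd_le1.
- exact: receiver_unknown_interference.
Qed.

(* Each receiver [i] is told [g xi + zj], what user [i] causes at the other receiver [j]. *)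
Lemma code_genie_bound L : 2 * (1 + g^-1) + 2 * g * A / s <= L -> 0 <= A ->
  (M1 * M2)%:R * (1 - e1 - e2) ^+ 2 <= (expR 1 * L * L) ^+ n.
Proof.
move=> HL A0; have k0 : 0 < g^-1 by rewrite invr_gt0.
have P0 : 0 <= 2 * g * A / s by rewrite divr_ge0 ?(ltW s0)// !mulr_ge0// ltW.
have L0 : 0 < L by lra.
apply: (@code_bound_gen R A a1 a2 s g n M1 M2 c M10 M20 cv e1 e2 e12 E1 E2 _
  ( fun i j p => pdfn s p.1 / avgd s t2 (tshift (t2 j) p.1) *
     kern (avgd s t1) (s * L) g^-1 (tshift (x1 i) (tshift (t2 j) p.1), tshift (t1 i) p.2))
  (fun i j p => pdfn s p.1 / avgd s t1 (tshift (t1 i) p.1) *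
     kern (avgd s t2) (s * L) g^-1 (tshift (x2 j) (tshift (t1 i) p.1), tshift (t2 j) p.2))).
- by rewrite exprn_ge0// !mulr_ge0 ?expR_ge0// ltW.
- move=> i j; apply: measurable_funM; first exact: mfrac.
  by apply: (measurableT_comp (mka _ _ _)); exact: mshift3.
- move=> i j; apply: measurable_funM; first exact: mfrac.
  by apply: (measurableT_comp (mka _ _ _)); exact: mshift3.
- by move=> i j p; rewrite mulr_ge0.
- by move=> i j p; rewrite mulr_ge0.
- move=> i j [z1 z2] /=; rewrite /kern /=.
  apply: ratio => //; first apply: (@pdfn2_le _ _ s L L _ _ (tshift (x1 i) (tshift (t2 j) z1))
      (tscale g^-1 (tshift (t1 i) z2)) (tshift (x2 j) (tshift (t1 i) z2))
      (tscale g^-1 (tshift (t2 j) z1))) => //.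
    move=> k; rewrite !tnth_mktuple.
    have -> : tnth (x1 i) k + (g * tnth (x2 j) k + tnth z1 k) -
      g^-1 * (g * tnth (x1 i) k + tnth z2 k) =
      g * tnth (x2 j) k + tnth z1 k - tnth z2 k / g by field; rewrite gt_eqF.
    have -> : tnth (x2 j) k + (g * tnth (x1 i) k + tnth z2 k) -
      g^-1 * (g * tnth (x2 j) k + tnth z1 k) =
      g * tnth (x1 i) k + tnth z2 k - tnth z1 k / g by field; rewrite gt_eqF.
    exact: (genie_comparison s0 g0 _ _ HL).
  (* Here the cancellation is crosswise: the genie density of each user is the denominator in the
     weight of the other. *)
  have av1 := avgd_gt0 t1 (tshift (t1 i) z2) s_neq0 M10.
  have av2 := avgd_gt0 t2 (tshift (t2 j) z1) s_neq0 M20.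
  by field; rewrite !gt_eqF.
- by apply: receiver_unknown_interference => //; exact: kern_avgd_le1.
- by apply: receiver_unknown_interference => //; exact: kern_avgd_le1.
Qed.

End code_converse.

(** * From codes to rates and to the sum capacity *)

Section rates.
Context {R : realType}.

Lemma powR_natM (x y : R) n : 0 < x -> x `^ (n%:R * y) = (x `^ y) ^+ n.
Proof. by move=> x0; rewrite mulrC powRrM powR_mulrn// powR_ge0. Qed.

Lemma le_log2 (x y : R) : 0 < y -> (2 `^ x <= y) = (x <= log2 y).
Proof.
move=> y0; have l2 : 0 < ln 2 :> R by rewrite ln_gt0// ltr1n.
rewrite /log2 ler_pdivlMr// -[in LHS](lnK (x := y))// /powR pnatr_eq0/= ler_expR.
by [].
Qed.

Lemma msg_sizeE n (r : R) : (msg_size n r)%:R = (Num.ceil (2 `^ (n%:R * r)))%:~R :> R.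
Proof.
have c0 : 0 < Num.ceil (2 `^ (n%:R * r)) by rewrite ceil_gt0 powR_gt0.
by rewrite /msg_size natr_absz gtr0_norm.
Qed.

Lemma msg_size_gt0 n (r : R) : (0 < msg_size n r)%N.
Proof. by rewrite -(ltr0n R) msg_sizeE ltr0z ceil_gt0 powR_gt0. Qed.

Lemma le_msg_size n (r : R) : (2 `^ r) ^+ n <= (msg_size n r)%:R.
Proof. by rewrite msg_sizeE -powR_natM// ceil_ge. Qed.

Lemma msg_size_lt n (r : R) : (msg_size n r)%:R - 1 < (2 `^ r) ^+ n.
Proof. by rewrite msg_sizeE -powR_natM// -[X in _ - X](mulr1z 1) -rmorphB ceilB1_lt. Qed.

(** By the Bernoulli inequality the powers of a number above 1 are unbounded. *)
Lemma exp_bounded_le1 (x C : R) N : 0 <= x ->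
  (forall n, (N <= n)%N -> x ^+ n <= C) -> x <= 1.
Proof.
move=> x0 H; rewrite leNgt; apply/negP => x1.
have B n : 1 + n%:R * (x - 1) <= x ^+ n.
  elim: n => [|n IH]; first by rewrite mul0r addr0 expr0.
  rewrite exprS -natr1.
  have : x * (1 + n%:R * (x - 1)) <= x * x ^+ n by rewrite ler_wpM2l.
  have : 0 <= n%:R * (x - 1) ^+ 2 by rewrite mulr_ge0 ?sqr_ge0.
  nra.
pose n := (N + `|Num.ceil (C / (x - 1))|.+1)%N.
have := H n (leq_addr _ _); apply/negP; rewrite -ltNge.
apply: lt_le_trans (B n).
have d0 : 0 < x - 1 by rewrite subr_gt0.
have : C / (x - 1) <= n%:R.
  apply: (le_trans (ceil_ge _)).
  rewrite (le_trans (ler_norm _))// -intr_norm -natr_absz ler_nat /n.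
  by rewrite (leq_trans _ (leq_addl _ _)).
rewrite ler_pdivrMr// => h; apply: (le_lt_trans h).
by rewrite ltrDr.
Qed.

Lemma rate_bound (g al A s K : R) (r : R * R) : 0 < K ->
  (forall n M1 M2 (c : Defs.code R n M1 M2) e1 e2, (0 < M1)%N -> (0 < M2)%N ->
     valid_code A al al c -> e1 + e2 <= 1 ->
     (err1 1 g s c <= e1%:E)%E -> (err2 1 g s c <= e2%:E)%E ->
     (M1 * M2)%:R * (1 - e1 - e2) ^+ 2 <= K ^+ n) ->
  achievable 1 g g 1 al al A s r -> r.1 + r.2 <= log2 K.
Proof.
move=> K0 HK [c [cv ce]].
(* Two errors of [1 / 4] leave the factor [(1 - 1 / 2) ^+ 2 = 1 / 4], a constant that does not grow
   with [n] and so does not affect the rate. *)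
have [N HN] := ce (1 / 4) ltac:(by lra).
rewrite -le_log2// -[leRHS]mul1r -ler_pdivrMr//.
apply: (@exp_bounded_le1 _ 4 N); first by rewrite divr_ge0// ?powR_ge0 ?ltW.
move=> n /HN[E1 E2].
rewrite expr_div_n ler_pdivrMr ?exprn_gt0//.
have H : 1 / 4 + 1 / 4 <= 1 :> R by lra.
have := HK n _ _ (c n) (1 / 4) (1 / 4) (msg_size_gt0 _ _) (msg_size_gt0 _ _) (cv n) H E1 E2.
have -> : (1 - 1 / 4 - 1 / 4) ^+ 2 = 1 / 4 :> R by field.
rewrite natrM powRD ?pnatr_eq0 ?implybT// exprMn => B.
have L : (2 `^ r.1) ^+ n * (2 `^ r.2) ^+ n <= (msg_size n r.1)%:R * (msg_size n r.2)%:R :> R.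
  by apply: ler_pM; rewrite ?exprn_ge0 ?powR_ge0//; exact: le_msg_size.
lra.
Qed.

(** The half-plane [r.1 + r.2 <= U] is closed, so the upper bound survives the closure; the
    achievable pair makes the set under [sup] nonempty. *)
Lemma Csum_bounds (g al A s L U : R) :
  (forall r, achievable 1 g g 1 al al A s r -> r.1 + r.2 <= U) ->
  (exists2 r, achievable 1 g g 1 al al A s r & r.1 + r.2 = L) ->
  L <= Csum 1 g g 1 al al A s <= U.
Proof.
move=> HU [r Hr rL].
have clU : closed [set r : R * R | r.1 + r.2 <= U].
  apply: (@closed_comp _ _ (fun r : R * R => r.1 + r.2) [set x | x <= U]); last exact: closed_le.
  by move=> x _; apply: cvgD; [exact: cvg_fst|exact: cvg_snd].
have sub : cap_region 1 g g 1 al al A s `<=` [set r : R * R | r.1 + r.2 <= U].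
  rewrite /cap_region; move/closure_id: clU => ->.
  by apply: closure_subset => x; exact: HU.
have ub : ubound [set r.1 + r.2 | r in cap_region 1 g g 1 al al A s] U.
  by move=> _ [x /sub xU <-].
have mem : [set r.1 + r.2 | r in cap_region 1 g g 1 al al A s] L.
  by exists r => //; exact: subset_closure.
apply/andP; split.
  by apply: ub_le_sup => //; exists U.
by apply: ge_sup => //; exists L.
Qed.

End rates.

(** * Coding over an interference-free alphabet *)

Section greedy.

(** Serves both the Gilbert-Varshamov code and the second grid. [ok] relates an earlier element to a
    later one and is not assumed symmetric. *)
Lemma greedy_seq (T : eqType) (Q : T -> Prop) (ok : T -> T -> Prop) (x0 : T) n :
  (forall s : seq T, (size s < n)%N -> (forall y, y \in s -> Q y) ->
     exists x, Q x /\ forall y, y \in s -> ok y x) ->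
  exists f : nat -> T, (forall i, (i < n)%N -> Q (f i)) /\
    forall i j, (i < j < n)%N -> ok (f i) (f j).
Proof.
move=> H; suff K m : (m <= n)%N -> exists s : seq T, [/\ size s = m,
    forall y, y \in s -> Q y &
    forall i j, (i < j < m)%N -> ok (nth x0 s i) (nth x0 s j)].
  have [s [sn Qs okS]] := K n (leqnn n).
  by exists (nth x0 s); split => // i ni; apply/Qs/mem_nth; rewrite sn.
elim: m => [|m IH] mn; first by exists [::]; split => // i j; rewrite ltn0 andbF.
have [s [sm Qs okS]] := IH (ltnW mn).
have [||x [Qx Hx]] := H s => //; first by rewrite sm.
exists (rcons s x); split; first by rewrite size_rcons sm.
  by move=> y; rewrite mem_rcons inE => /orP[/eqP ->|/Qs].
move=> i j /andP[ij]; rewrite ltnS leq_eqVlt => /orP[/eqP jm|jm].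
  rewrite !nth_rcons sm jm eqxx ltnn -jm ij.
  by apply: Hx; apply: mem_nth; rewrite sm -jm.
rewrite !nth_rcons sm jm (ltn_trans ij jm).
by apply: okS; rewrite ij.
Qed.

Variables (n : nat) (S : finType).

Definition hdist (x y : {ffun 'I_n -> S}) : nat := #|[set k | x k != y k]%SET|.

Lemma card_agree_off (B : {set 'I_n}) (c : {ffun 'I_n -> S}) :
  #|[set x : {ffun 'I_n -> S} | [forall i, (i \in B) || (x i == c i)]]%SET| = (#|S| ^ #|B|)%N.
Proof.
pose F i : pred S := [pred s | (i \in B) || (s == c i)].
transitivity #|family F|.
  apply: eq_card => x; rewrite [LHS]inE; apply/idP/idP => [/fintype.forallP H|/familyP H].
    by apply/familyP => i; have := H i.
  by apply/fintype.forallP => i; have := H i.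
rewrite card_family foldrE big_map big_enum /=.
rewrite (bigID (mem B)) /= [X in (_ * X)%N]big1 ?muln1; last first.
  move=> i iB; rewrite -(card1 (c i)); apply: eq_card => s.
  by rewrite !inE (negbTE iB).
rewrite -prod_nat_const; apply: eq_bigr => i iB.
by apply: eq_card => s; rewrite !inE iB.
Qed.

(** A word of the ball is determined by a set of at most [r] positions and its letters there.
    Counting all [2 ^ n] sets is crude, but costs one bit per letter, a constant in the rate. *)
Lemma card_hball (c : {ffun 'I_n -> S}) (r : nat) : (0 < #|S|)%N ->
  (#|[set x | hdist c x <= r]%SET| <= 2 ^ n * #|S| ^ r)%N.
Proof.
move=> S0.
pose P (B : {set 'I_n}) := [set x : {ffun 'I_n -> S} | [forall i, (i \in B) || (x i == c i)]]%SET.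
pose Q := [set B : {set 'I_n} | (#|B| <= r)%N]%SET.
apply: (@leq_trans #|(\bigcup_(B in Q) P B)%SET|).
  apply: subset_leq_card; apply/fintype.subsetP => x; rewrite inE => xr.
  apply/bigcupP; exists [set k | c k != x k]%SET; first by rewrite inE.
  by rewrite inE; apply/fintype.forallP => i; rewrite inE eq_sym orNb.
apply: (@leq_trans (\sum_(B in Q) #|P B|)).
  elim/big_rec2: _ => [|B a b _ ab]; first by rewrite cards0.
  by rewrite (leq_trans (leq_card_setU _ _))// leq_add2l.
apply: (@leq_trans (\sum_(B in Q) #|S| ^ r)).
  apply: leq_sum => B; rewrite inE => Br; rewrite card_agree_off.
  by rewrite leq_pexp2l.
rewrite sum_nat_const leq_mul2r; apply/orP; right.
rewrite (leq_trans (max_card _))//.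
by rewrite -cardsT -powersetT card_powerset cardsT card_ord.
Qed.

(** A new word has to avoid at most [M.-1] balls. By [msg_size_lt] this predecessor lies below the
    power of 2 inside the ceiling of [msg_size], so rounding up costs nothing. *)
Lemma gilbert_varshamov (M r : nat) : (0 < #|S|)%N ->
  (M.-1 * (2 ^ n * #|S| ^ r) < #|S| ^ n)%N ->
  exists e : 'I_M -> {ffun 'I_n -> S}, forall i j, i != j -> (r < hdist (e i) (e j))%N.
Proof.
move=> S0 H; have [s0 _] := card_gt0P S0.
have [s sM _|f [_ fP]] :=
  @greedy_seq _ (fun=> True) (fun x y => (r < hdist x y)%N) [ffun=> s0] M.
  have /fintype.subsetPn[x _ xP] : ~~ ([set: {ffun 'I_n -> S}]%SET \subset
      (\bigcup_(y <- s) [set x | (hdist y x <= r)%N])%SET).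
    apply/negP => /subset_leq_card; apply/negP; rewrite -ltnNge.
    rewrite cardsT card_ffun card_ord; apply: leq_ltn_trans H.
    apply: (@leq_trans (size s * (2 ^ n * #|S| ^ r))).
      elim: s {sM} => [|y s IH]; first by rewrite big_nil cards0.
      rewrite big_cons (leq_trans (leq_card_setU _ _))//= mulSn.
      by rewrite leq_add ?card_hball.
    by rewrite leq_mul2r; apply/orP; right; case: M sM.
  exists x; split => // y ys; rewrite ltnNge; apply/negP => yx.
  by move/negP: xP; apply; rewrite (big_rem y)//= inE inE yx.
exists (fun i => f i) => i j; rewrite -val_eqE neq_ltn => /orP[] ij.
  by apply: fP; rewrite ij ltn_ord.
rewrite /hdist (_ : [set k | _]%SET = [set k | f j k != f i k]%SET).
  by apply: fP; rewrite ij ltn_ord.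
by apply/setP => k; rewrite !inE eq_sym.
Qed.

End greedy.

(** * Probability of many large noise samples *)

Section gaussian_tail.
Context {R : realType}.
Local Notation leb := (@lebesgue_measure R).

Lemma measurable_gt_norm d (T : measurableType d) (t : R) (f : T -> R) :
  measurable_fun setT f -> measurable_fun setT (fun x => (t < `|f x|)%R%:R : R).
Proof.
move=> mf; apply: (measurableT_comp (f := fun b : bool => b%:R : R)) => //.
apply: measurable_fun_ltr => //.
exact: measurableT_comp.
Qed.

(* The density of [N(0, s^2)] beyond [t s] is at most [2 exp (- 3 t^2 / 8)] times the
   density of [N(0, (2 s)^2)], which integrates to [1]. *)
Lemma normal_tail (s t : R) : 0 < s -> 0 <= t ->
  (\int[normal_prob 0 s]_z (t * s < `|z|)%R%:R%:E <= (2 * expR (- (3 / 8 * t ^+ 2)))%:E)%E.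
Proof.
move=> s0 t0.
have mb : measurable_fun setT (fun z : R => (t * s < `|z|)%R%:R : R).
  exact: measurable_gt_norm.
have mpdf L : measurable_fun setT (fun z : R => (normal_pdf 0 L z)%:E).
  by apply/measurable_EFinP; exact: measurable_normal_pdf.
rewrite integral_normal_prob//; last exact/measurable_EFinP.
  rewrite -[leRHS]mule1 -(integral_normal_pdf 0 (s * 2)) -ge0_integralZl//; last 2 first.
  - exact: mpdf.
  - by move=> z _; rewrite lee_fin normal_pdf_ge0.
  apply: ge0_le_integral => //.
  - by move=> z _; rewrite -EFinM lee_fin mulr_ge0 ?normal_pdf_ge0.
  - by apply: emeasurable_funM; [exact/measurable_EFinP|exact: mpdf].
  - by apply: emeasurable_funM; [exact: measurable_cst|exact: mpdf].
  move=> z _; rewrite -!EFinM lee_fin.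
  have [tz|_] := boolP (t * s < `|z|); last first.
    by rewrite mul0r !mulr_ge0 ?expR_ge0 ?normal_pdf_ge0.
  rewrite mul1r -{1}(mulr1 s) !normal_pdf_scale//.
  have -> : 2 * expR (- (3 / 8 * t ^+ 2)) *
      (normal_peak s / 2 * expR (- (z / 2) ^+ 2 / (s ^+ 2 *+ 2))) =
      normal_peak s * expR (- (3 / 8 * t ^+ 2) - (z / 2) ^+ 2 / (s ^+ 2 *+ 2)).
    by rewrite expRD mulNr; field.
  rewrite !divr1 ler_wpM2l ?normal_peak_ge0// ler_expR -(mulr_natr (s ^+ 2)).
  have zt : t ^+ 2 <= z ^+ 2 / s ^+ 2.
    rewrite ler_pdivlMr ?exprn_gt0// -exprMn -(real_normK (num_real z)).
    by rewrite ler_pXn2r ?nnegrE//; [exact: ltW|exact: mulr_ge0 t0 (ltW s0)].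
  have -> : - z ^+ 2 / (s ^+ 2 * 2) = - (1 / 2) * (z ^+ 2 / s ^+ 2).
    by field; rewrite gt_eqF.
  have -> : (z / 2) ^+ 2 / (s ^+ 2 * 2) = 1 / 8 * (z ^+ 2 / s ^+ 2).
    by field; rewrite gt_eqF.
  lra.
Qed.

Definition nbad n (t : R) (y c : n.-tuple R) : R :=
  \sum_(i < n) (t < `|tnth y i - tnth c i|)%R%:R.

Lemma measurable_nbad n t (c : n.-tuple R) : measurable_fun setT (fun y => nbad t y c).
Proof.
apply: measurable_sum => i; apply: measurable_gt_norm.
by apply: measurable_funB => //; exact: measurable_tnth.
Qed.

(** Chernoff bound: [2 ^ nbad] is a product over independent letters of the factors [w], which are 1
    or 2, so its expectation is the [n]-th power of 1 plus the probability of one large sample. *)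
Lemma gauss_int_nbad n (s t D : R) (f : n.-tuple R -> bool) : 0 < s -> 0 <= t ->
  measurable_fun setT (fun z => (f z)%:R : R) ->
  (forall z, f z -> D <= nbad (t * s) z [tuple 0 | _ < n]) ->
  (gauss_int s (fun z => (f z)%:R%:E) <=
    ((1 + 2 * expR (- (3 / 8 * t ^+ 2))) ^+ n * 2 `^ (- D))%:E)%E.
Proof.
move=> s0 t0 mf Hf; rewrite gauss_intE.
pose w (z : R) : R := 1 + (t * s < `|z|)%R%:R.
have mw : measurable_fun setT w.
  by apply: measurable_funD => //; exact: measurable_gt_norm.
have w0 z : 0 <= w z by rewrite addr_ge0.
have mp : measurable_fun setT (fun z : n.-tuple R => \prod_(i < n) w (tnth z i)).
  by apply: measurable_prod => i _; apply: (measurableT_comp mw); exact: measurable_tnth.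
have wE (z : n.-tuple R) : \prod_(i < n) w (tnth z i) = 2 `^ nbad (t * s) z [tuple 0 | _ < n].
  rewrite /nbad /powR pnatr_eq0/= mulr_suml expR_sum.
  apply: eq_bigr => i _; rewrite tnth_mktuple subr0 /w.
  case: (t * s < _) => /=; rewrite ?mul1r ?mul0r ?expR0 ?addr0//.
  by rewrite lnK ?posrE//.
have P0 : 0 <= 2 `^ (- D) by rewrite powR_ge0.
apply: (@le_trans _ _ (pint (normal_prob 0 s)
    (fun z : n.-tuple R => (2 `^ (- D))%:E * (\prod_(i < n) w (tnth z i))%:E)%E)).
  apply: (@pint_le _ (measurableTypeR R)).
  - exact/measurable_EFinP.
  - by apply: emeasurable_funM => //; exact/measurable_EFinP.
  - by move=> z; rewrite lee_fin.
  - move=> z; rewrite -EFinM lee_fin wE -powRD ?pnatr_eq0 ?implybT//.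
    have [/Hf fz|_] := boolP (f z); last by rewrite powR_ge0.
    apply: (@le_trans _ _ (2 `^ 0)); first by rewrite powRr0.
    by rewrite ler_powR ?ler1n// addrC subr_ge0.
rewrite (@pintZ _ (measurableTypeR R))//; last 2 first.
- exact/measurable_EFinP.
- by move=> z; rewrite lee_fin prodr_ge0.
rewrite (@pint_prod _ (measurableTypeR R))// mulrC EFinM lee_wpmul2l ?lee_fin//.
set I := (\int[normal_prob 0 s]_z (w z)%:E)%E.
have I0 : (0 <= I)%E by apply: integral_ge0 => z _; rewrite lee_fin.
have Ile : (I <= (1 + 2 * expR (- (3 / 8 * t ^+ 2)))%:E)%E.
  rewrite /I (_ : (fun z => _) = (fun z => 1 + (t * s < `|z|)%R%:R%:E)%E)//.
  rewrite ge0_integralD//; last by apply/measurable_EFinP; exact: measurable_gt_norm.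
  rewrite integral_cst// mul1e EFinD leeD//; last exact: normal_tail.
  by rewrite [leLHS](@probability_setT _ _ _ (normal_prob 0 s)).
move: I I0 Ile => [v| |] // v0 vle.
rewrite -EFin_expe lee_fin; rewrite !lee_fin in v0 vle.
by rewrite lerXn2r// nnegrE// (le_trans v0).
Qed.

End gaussian_tail.

(** * A measurable threshold decoder *)

Section decoder.
Context {R : realType} (n M M' : nat).
Variables (cc : 'I_M -> 'I_M' -> n.-tuple R) (T D : R) (m0 : 'I_M).

(** The interfering message is guessed jointly; [D] is the number of letters at which the noise may
    exceed [T]. *)
Definition plausible i y := [exists j, nbad T y (cc i j) <= D].

Definition tdecode (y : n.-tuple R) : 'I_M :=
  foldr (fun i acc => if plausible i y then i else acc) m0 (enum 'I_M).

Lemma measurable_plausible i : measurable [set y | plausible i y].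
Proof.
rewrite (_ : [set y | _] =
    \big[setU/set0]_(j <- enum 'I_M') [set y | nbad T y (cc i j) <= D]).
  apply: bigsetU_measurable => j _.
  rewrite (_ : [set y | _] = (fun y => nbad T y (cc i j)) @^-1` `]-oo, D]%classic).
    rewrite -[X in measurable X]setTI.
    by apply: (measurable_nbad T (cc i j)) => //; exact: measurable_itv.
  by apply/seteqP; split => y /=; rewrite in_itv.
rewrite -bigcup_seq; apply/seteqP; split => [y /existsP[j yj]|y [j _ yj]] /=.
  by exists j => //=; rewrite mem_enum.
by apply/existsP; exists j.
Qed.

Lemma measurable_decode m : measurable (tdecode @^-1` [set m]).
Proof.
rewrite /tdecode; elim: (enum 'I_M) => [|i r IH] /=.
  have [->|mm0] := eqVneq m0 m.
    by rewrite (_ : _ @^-1` _ = setT)//; apply/seteqP; split.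
  rewrite (_ : _ @^-1` _ = set0)//; apply/seteqP; split => // y /= /eqP.
  by rewrite (negbTE mm0).
rewrite (_ : _ @^-1` _ = ([set y | plausible i y] `&` (if i == m then setT else set0)) `|`
  (~` [set y | plausible i y] `&`
    ((fun y => foldr (fun i acc => if plausible i y then i else acc) m0 r) @^-1` [set m]))).
  apply: measurableU; apply: measurableI => //.
  - exact: measurable_plausible.
  - by case: ifP.
  - by apply: measurableC; exact: measurable_plausible.
apply/seteqP; split => y /=.
  by case: ifPn => yi; [move=> <-; left; rewrite eqxx|right; split => //; apply/negP].
case=> [[yi]|[/negP yi]].
  by rewrite yi; case: ifP => // /eqP.
by rewrite (negbTE yi).
Qed.

Lemma decode_unique i y : plausible i y -> (forall i', plausible i' y -> i' = i) ->
  tdecode y = i.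
Proof.
move=> Pi U; have : i \in enum 'I_M by rewrite mem_enum.
rewrite /tdecode; elim: (enum 'I_M) => [//|i' r IH] /=.
rewrite inE => /orP[/eqP <-|ir]; first by rewrite Pi.
by case: ifPn => [/U//|_]; exact: IH.
Qed.

End decoder.

Section separated_alphabets.
Context {R : realType} (S : finType) (g T D : R) (n M M' : nat).
Variables (u u' : S -> R) (e : 'I_M -> {ffun 'I_n -> S}) (e' : 'I_M' -> {ffun 'I_n -> S}).
Hypothesis sep : forall a a' b b', a != a' -> 2 * T < `|u a + g * u' b - (u a' + g * u' b')|.
Hypothesis dist : forall i i', i != i' -> 2 * D < (hdist (e i) (e i'))%:R.

Definition word i : n.-tuple R := [tuple u (e i k) | k < n].
Definition word' i : n.-tuple R := [tuple u' (e' i k) | k < n].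

(** Suppose [i'] were plausible as well. By [sep], wherever [e i] and [e i'] differ, one of the two
    residuals exceeds [T]; so the words would differ in at most [2 * D] letters. *)
Lemma decode_word m0 i j (z : n.-tuple R) : nbad T z [tuple 0 | _ < n] <= D ->
  tdecode (fun i j => chan_out 1 g (word i) (word' j) [tuple 0 | _ < n]) T D m0
    (chan_out 1 g (word i) (word' j) z) = i.
Proof.
move=> zD; set y := chan_out 1 g _ _ z.
pose cc i j := chan_out 1 g (word i) (word' j) [tuple 0 | _ < n].
have yE : nbad T y (cc i j) = nbad T z [tuple 0 | _ < n].
  apply: eq_bigr => k _; have -> : tnth y k - tnth (cc i j) k = tnth z k - tnth [tuple 0 | _ < n] k.
    by rewrite !tnth_mktuple; ring.
  by [].
apply: decode_unique; first by apply/existsP; exists j; rewrite yE.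
move=> i' /existsP[j' H']; case: (eqVneq i' i) => // ii'; exfalso.
have H : nbad T y (cc i j) <= D by rewrite yE.
have := dist ii'; rewrite ltNge => /negP; apply.
suff : (hdist (e i') (e i))%:R <= nbad T y (cc i j) + nbad T y (cc i' j') by lra.
rewrite /hdist -sum1_card natr_sum /nbad -big_split /= big_mkcond /=.
apply: ler_sum => k _; rewrite inE.
case: ifPn => [ek|_]; last by rewrite addr_ge0.
have [h1|h1] := ltP T `|tnth y k - tnth (cc i j) k|; first by rewrite lerDl.
have [h2|h2] := ltP T `|tnth y k - tnth (cc i' j') k|; first by rewrite lerDr.
have := sep (e' j' k) (e' j k) ek; rewrite ltNge => /negP[].
have -> : u (e i' k) + g * u' (e' j' k) - (u (e i k) + g * u' (e' j k)) =
  (tnth y k - tnth (cc i j) k) - (tnth y k - tnth (cc i' j') k).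
  by rewrite !tnth_mktuple; ring.
by rewrite (le_trans (ler_normB _ _))//; lra.
Qed.

End separated_alphabets.

(** * Vanishing error over an interference-free alphabet *)

Section achievability.
Context {R : realType} (S : finType) (al A s g t ep : R) (u1 u2 : S -> R).
Hypothesis s0 : 0 < s.
Hypothesis t0 : 0 <= t.
Hypothesis ep0 : 0 < ep.
Hypothesis S0 : (0 < #|S|)%N.
Hypothesis A0 : 0 <= A.
Hypothesis al1 : al <= 1.
Hypothesis tail : 1 + 2 * expR (- (3 / 8 * t ^+ 2)) < 2 `^ ep.
Hypothesis u1A : forall a, 0 <= u1 a <= al * A.
Hypothesis u2A : forall a, 0 <= u2 a <= al * A.
Hypothesis sep1 : forall a a' b b', a != a' ->
  2 * (t * s) < `|u1 a + g * u2 b - (u1 a' + g * u2 b')|.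
Hypothesis sep2 : forall a a' b b', a != a' ->
  2 * (t * s) < `|u2 a + g * u1 b - (u2 a' + g * u1 b')|.

(** Relative distance [2 * ep] costs the factor [1 - 2 * ep], and the [2 ^ n] in the ball count
    costs the 1. A negative value is allowed: [msg_size] is then 1. *)
Let rate := (1 - 2 * ep) * log2 (#|S|%:R : R) - 1.

(** The error probability will be at most [x ^+ n]; the hypothesis [tail] says that [x] is below
    1. *)
Let x := (1 + 2 * expR (- (3 / 8 * t ^+ 2))) * 2 `^ (- ep).

Let q1 : 1 <= #|S|%:R :> R. Proof. by rewrite ler1n. Qed.

Lemma codebook n : exists e : 'I_(msg_size n rate) -> {ffun 'I_n -> S},
  forall i i', i != i' -> 2 * (n%:R * ep) < (hdist (e i) (e i'))%:R.
Proof.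
pose r := `|Num.floor (2 * (n%:R * ep))|%N.
have D0 : 0 <= 2 * (n%:R * ep) by rewrite !mulr_ge0// ltW.
have rE : r%:R = (Num.floor (2 * (n%:R * ep)))%:~R :> R.
  by rewrite /r natr_absz ger0_norm// floor_ge0.
have [|e He] := @gilbert_varshamov n S (msg_size n rate) r S0.
  rewrite -(ltr_nat R) !natrM !natrX.
  set q : R := #|S|%:R.
  have qp : 0 < q by apply: lt_le_trans q1.
  have M1 : (msg_size n rate).-1%:R < (2 `^ rate) ^+ n :> R.
    apply: le_lt_trans (msg_size_lt n rate).
    by rewrite -subn1 natrB ?msg_size_gt0.
  have rq : (2 `^ rate) ^+ n = q `^ (n%:R * (1 - 2 * ep)) / 2 ^+ n.
    rewrite powR_natM// -expr_div_n; congr (_ ^+ n).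
    rewrite /rate /powR pnatr_eq0 gt_eqF//= mulrBl expRB mul1r lnK ?posrE//.
    rewrite (gt_eqF qp); congr (expR _ / _); rewrite /log2 -mulrA divfK// gt_eqF// ln_gt0// ltr1n.
    by [].
  have r_le : q ^+ r <= q `^ (2 * (n%:R * ep)).
    by rewrite -(powR_mulrn _ (ltW qp)) ler_powR// rE Num.Theory.floor_le.
  have -> : q ^+ n = q `^ (n%:R * (1 - 2 * ep)) / 2 ^+ n * (2 ^+ n * q `^ (2 * (n%:R * ep))).
    rewrite mulrA divfK ?expf_neq0 ?pnatr_eq0// -powRD ?(gt_eqF qp) ?implybT//.
    by rewrite -(powR_mulrn _ (ltW qp)); congr (_ `^ _); ring.
  rewrite -rq; apply: (@lt_le_trans _ _ ((2 `^ rate) ^+ n * (2 ^+ n * q ^+ r))).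
    by rewrite ltr_pM2r// mulr_gt0 ?exprn_gt0.
  by rewrite ler_wpM2l ?exprn_ge0 ?powR_ge0// ler_wpM2l ?exprn_ge0.
exists e => i i' /He; rewrite -(ltr_nat R) => h.
have : Num.floor (2 * (n%:R * ep)) + 1 <= (hdist (e i) (e i'))%:Z.
  move: h; rewrite ltr_nat => h.
  have -> : Num.floor (2 * (n%:R * ep)) = r%:Z by rewrite /r gez0_abs// floor_ge0.
  by rewrite -PoszD lez_nat addn1.
rewrite -(ler_int R) => h2; apply: lt_le_trans h2.
by rewrite floorD1_gt.
Qed.

Lemma code_error n : exists c : Defs.code R n (msg_size n rate) (msg_size n rate),
  [/\ valid_code A al al c, (err1 1 g s c <= (x ^+ n)%:E)%E & (err2 1 g s c <= (x ^+ n)%:E)%E].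
Proof.
have [e1 d1] := codebook n; have [e2 d2] := codebook n.
pose m0 : 'I_(msg_size n rate) := Ordinal (msg_size_gt0 n rate).
pose D := n%:R * ep.
pose z0 : n.-tuple R := [tuple 0 | _ < n].
pose f1 := tdecode (fun i j => chan_out 1 g (word u1 e1 i) (word u2 e2 j) z0) (t * s) D m0.
pose f2 := tdecode (fun i j => chan_out 1 g (word u2 e2 i) (word u1 e1 j) z0) (t * s) D m0.
pose c := Defs.Code (word u1 e1) (word u2 e2) f1 f2.
have xE : (1 + 2 * expR (- (3 / 8 * t ^+ 2))) ^+ n * 2 `^ (- D) = x ^+ n.
  by rewrite /x exprMn -powR_natM// mulrN.
have ok u (e : 'I_(msg_size n rate) -> {ffun 'I_n -> S}) m : (forall a, 0 <= u a <= al * A) ->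
    input_ok A al (word u e m).
  move=> uA; split.
    move=> k; rewrite tnth_mktuple; have /andP[-> h] := uA (e m k).
    by rewrite (le_trans h)// ler_piMl.
  apply: (@le_trans _ _ (\sum_(k < n) al * A)).
    by apply: ler_sum => k _; rewrite tnth_mktuple; have /andP[_] := uA (e m k).
  by rewrite sumr_const card_ord mulr_natr.
have vc : valid_code A al al c.
  split; first by move=> m; exact: ok.
  split; first by move=> m; exact: ok.
  by split => m; exact: measurable_decode.
have one v v' (e e' : 'I_(msg_size n rate) -> {ffun 'I_n -> S}) i j :
    (forall a a' b b', a != a' -> 2 * (t * s) < `|v a + g * v' b - (v a' + g * v' b')|) ->
    (forall i i', i != i' -> 2 * D < (hdist (e i) (e i'))%:R) ->
    (gauss_int s (fun z => if tdecode (fun i j => chan_out 1 g (word v e i) (word v' e' j) z0)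
       (t * s) D m0 (chan_out 1 g (word v e i) (word v' e' j) z) != i then 1 else 0)
     <= (x ^+ n)%:E)%E.
  move=> sep dist.
  set dc := tdecode _ _ _ _.
  pose fl z := dc (chan_out 1 g (word v e i) (word v' e' j) z) != i.
  rewrite (_ : (fun z => _) = (fun z => (fl z)%:R%:E)); last first.
    by apply/funext => z; rewrite /fl; case: (_ != _).
  rewrite -xE; apply: gauss_int_nbad => //.
  - have md m : measurable (dc @^-1` [set m]) by exact: measurable_decode.
    rewrite (_ : (fun z => _) = (fun z => 1 - (dc (tshift (word v e i)
        (tshift (tscale g (word v' e' j)) z)) == i)%:R)); last first.
      by apply/funext => z; rewrite /fl chan_out_tshift; case: eqP; rewrite ?subrr ?subr0.
    apply: measurable_funB => //; apply: (measurable_dec_comp md).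
    exact: (measurableT_comp (measurable_tshift _) (measurable_tshift _)).
  - move=> z; apply: contraNT; rewrite -ltNge => /ltW zD.
    by apply/eqP; exact: decode_word.
have Mp : 0 < (msg_size n rate * msg_size n rate)%:R :> R.
  by rewrite ltr0n muln_gt0 msg_size_gt0.
have sumle (F : 'I_(msg_size n rate) -> 'I_(msg_size n rate) -> \bar R) :
    (forall i j, (F i j <= (x ^+ n)%:E)%E) ->
    (((msg_size n rate * msg_size n rate)%:R^-1)%:E * (\sum_i \sum_j F i j) <= (x ^+ n)%:E)%E.
  move=> HF; rewrite lee_pdivrMl//.
  apply: (@le_trans _ _ (\sum_(i < msg_size n rate) \sum_(j < msg_size n rate) (x ^+ n)%:E)%E).
    by apply: lee_sum => i _; apply: lee_sum => j _.
  under eq_bigr do rewrite sumEFin.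
  rewrite sumEFin -EFinM lee_fin !sumr_const card_ord -mulrnA -[leLHS]mulr_natl.
  by [].
exists c; split => //.
- by apply: sumle => i j; exact: one.
- by apply: sumle => i j; exact: one.
Qed.

Lemma achievable_separated : achievable 1 g g 1 al al A s (rate, rate).
Proof.
pose c n := projT1 (cid (code_error n)).
have cP n : [/\ valid_code A al al (c n), (err1 1 g s (c n) <= (x ^+ n)%:E)%E &
    (err2 1 g s (c n) <= (x ^+ n)%:E)%E] by exact: (projT2 (cid (code_error n))).
exists c; split => [n|eps eps0]; first by have [] := cP n.
have x0 : 0 <= x by rewrite mulr_ge0 ?powR_ge0// addr_ge0// mulr_ge0// expR_ge0.
have x1 : `|x| < 1.
  by rewrite ger0_norm// /x powRN ltr_pdivrMr ?powR_gt0// mul1r.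
have := cvg_expr x1 => /cvgrPdist_le /(_ _ eps0)[N _ HN].
exists N => n Nn; have [_ h1 h2] := cP n.
have xn : x ^+ n <= eps.
  have := HN n Nn; rewrite /= sub0r normrN ger0_norm ?exprn_ge0//.
by split; [apply: (le_trans h1)|apply: (le_trans h2)]; rewrite lee_fin.
Qed.

End achievability.

(** * Interference-free alphabets *)

Section separated_grids.
Context {R : realType}.
Local Notation leb := (@lebesgue_measure R).

(** Intervals of total length below [W] cannot cover [[0, W]]. *)
Lemma exists_avoiding (W : R) (I : seq (R * R)) : 0 < W ->
  (forall p, p \in I -> 0 <= p.2) -> \sum_(p <- I) (2 * p.2) < W ->
  exists y, 0 <= y <= W /\ forall p, p \in I -> p.2 < `|y - p.1|.
Proof.
move=> W0 I0 IW.
pose U (J : seq (R * R)) := \big[setU/set0]_(p <- J) (`[p.1 - p.2, p.1 + p.2]%classic : set R).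
have mU J : measurable (U J) by apply: bigsetU_measurable => p _; exact: measurable_itv.
have UJ J : (forall p, p \in J -> 0 <= p.2) -> (leb (U J) <= (\sum_(p <- J) (2 * p.2))%:E)%E.
  elim: J => [|p J IH] J0; first by rewrite /U !big_nil measure0.
  rewrite /U !big_cons EFinD; apply: (le_trans (measureU2 _ _ _)) => //.
  - exact: mU.
  apply: leeD; last by apply: IH => q qJ; apply: J0; rewrite inE qJ orbT.
  have p20 : 0 <= p.2 by apply: J0; rewrite inE eqxx.
  rewrite [leLHS](lebesgue_measure_itv `[p.1 - p.2, p.1 + p.2]) /= lte_fin; case: ifP => _.
    by rewrite -EFinD lee_fin; lra.
  by rewrite lee_fin mulr_ge0.
apply: contrapT => H.
have sub : `[0, W]%classic `<=` U I.
  move=> y; rewrite /= in_itv/= => yW; apply: contrapT => yU; apply: H.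
  exists y; split => // p pI; rewrite ltNge; apply/negP => yp; apply: yU.
  rewrite /U -bigcup_seq; exists p => //=.
  by rewrite in_itv/=; move: yp; rewrite ler_norml => /andP[]; lra.
have : (leb `[0%R, W]%classic <= leb (U I))%E.
  by apply: le_measure; rewrite ?inE//; exact: mU.
move=> /le_trans /(_ (UJ _ I0)).
rewrite [leLHS](lebesgue_measure_itv `[0, W]) /= lte_fin W0 -EFinD lee_fin oppr0 addr0.
by rewrite leNgt IW.
Qed.

(** Small differences are written [k - B] with [k] natural, so that [iota] lists the intervals to
    avoid. *)
Lemma natr_absdist (i i' B : nat) :
  (exists2 k, (k <= 2 * B)%N & k%:R - B%:R = i%:R - i'%:R :> R) \/
  B%:R + 1 <= `|i%:R - i'%:R| :> R.
Proof.
have [h1|h1] := leqP i' (i + B).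
  have [h2|h2] := leqP i (i' + B).
    left; exists (i + B - i')%N; first by lia.
    by rewrite natrB// natrD; ring.
  right; rewrite ger0_norm; last by rewrite subr_ge0 ler_nat; lia.
  by rewrite lerBrDr natr1 -natrD ler_nat; lia.
right; rewrite ler0_norm; last by rewrite subr_le0 ler_nat; lia.
by rewrite opprB lerBrDr natr1 -natrD ler_nat; lia.
Qed.

Definition sep_grids (M : nat) (g D W : R) :=
  exists c1 c2 : 'I_M -> R, [/\ forall i, 0 <= c1 i <= W, forall i, 0 <= c2 i <= W &
    forall i j i' j', (i, j) != (i', j') ->
      D < `|c1 i - c1 i' + g * (c2 j - c2 j')| /\
      D < `|g * (c1 i - c1 i') + (c2 j - c2 j')| ].

Lemma sep_grids1 (g D W : R) : 0 <= W -> sep_grids 1 g D W.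
Proof.
move=> W0; exists (fun=> 0), (fun=> 0); split => [i|i|i j i' j'].
- by rewrite lexx.
- by rewrite lexx.
by rewrite !ord1 eqxx.
Qed.

(* The points of the second grid are chosen greedily: a new point must avoid, for each
   earlier point and each relevant difference of the first grid, one interval per receiver. *)
Lemma sep_grids_weak (M : nat) (g D W : R) : (0 < M)%N -> 0 < g <= 1 -> 0 < D -> 0 < W ->
  8 * D * M%:R <= g * W -> 56 * D * M%:R ^+ 2 <= W -> sep_grids M g D W.
Proof.
move=> M0 /andP[g0 g1] D0 W0 H1 H2.
have Mr : 1 <= M%:R :> R by rewrite ler1n.
have Mp : 0 < M%:R :> R by lra.
pose h := W / M%:R.
have h0 : 0 < h by rewrite divr_gt0.
have hM : h * M%:R = W by rewrite /h divfK// gt_eqF.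
have gh : 8 * D <= g * h by rewrite /h mulrA ler_pdivlMr.
have gh1 : g * h <= h by rewrite ler_piMl// ltW.
(* At receiver 1 an index difference above [2 g M] moves the output by more than [2 g W], while the
   second grid can move it back by at most [g W]. Only differences up to [B] need an interval
   there. *)
pose B := Num.truncn (2 * g * M%:R).
have B0 : 0 <= 2 * g * M%:R by rewrite !mulr_ge0// ltW.
have /andP[B1 B2] : B%:R <= 2 * g * M%:R < B.+1%:R by apply: truncn_itv.
have B3 : 0 <= B%:R :> R by rewrite ler0n.
pose ok (x y : R) := forall i i', (i < M)%N -> (i' < M)%N ->
  D < `|(i%:R - i'%:R) * h + g * (y - x)| /\ D < `|g * ((i%:R - i'%:R) * h) + (y - x)|.
have [s sM sW|f [fW fok]] := @greedy_seq _ (fun x : R => 0 <= x <= W) ok 0 M.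
  pose I1 := [seq (x - (k%:R - B%:R) * h / g, D / g) | x <- s, k <- iota 0 (2 * B).+1].
  pose I2 := [seq (x - g * ((k%:R - M%:R) * h), D) | x <- s, k <- iota 0 (2 * M).+1].
  have [||y [yW Hy]] := @exists_avoiding W (I1 ++ I2) W0.
  - move=> p; rewrite mem_cat => /orP[] /allpairsP[q [_ _ ->]] /=; last exact: ltW.
    by rewrite divr_ge0// ltW.
  - rewrite big_cat /= !big_allpairs_dep /=.
    have st (a : R) k m : (a + a *+ k) *+ m = m%:R * ((k%:R + 1) * a).
      by rewrite -mulrS -mulrnA -[LHS]mulr_natr natrM -natr1; ring.
    rewrite !big_const_seq !count_predT /= !size_iota !iter_addr_0 !st !natrM.
    have sMr : (size s)%:R + 1 <= M%:R :> R by rewrite natr1 ler_nat.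
    have s0 : 0 <= (size s)%:R :> R by rewrite ler0n.
    have Dg : D / g * g = D by rewrite divfK// gt_eqF.
    set d := D / g in Dg *.
    have d0 : 0 < d by rewrite divr_gt0.
    have Md : 8 * d * M%:R <= W.
      rewrite -(ler_pM2l g0); have -> : g * (8 * d * M%:R) = 8 * (d * g) * M%:R by ring.
      by rewrite Dg.
    (* The total length is at most [14 D M^2 + 2 D M / g]; the constants 56 and 8 of the hypotheses
       make each term at most [W / 4]. *)
    apply: (@le_lt_trans _ _ (M%:R * ((4 * g * M%:R + 1) * 2 * d + 6 * M%:R * D))); last first.
      have -> : M%:R * ((4 * g * M%:R + 1) * 2 * d + 6 * M%:R * D) =
        8 * M%:R ^+ 2 * (d * g) + 2 * M%:R * d + 6 * M%:R ^+ 2 * D by ring.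
      rewrite Dg; lra.
    rewrite -mulrDr.
    apply: ler_pM => //.
    + by apply: addr_ge0; apply: mulr_ge0; lra.
    + lra.
    + apply: lerD.
        have : (2 * B%:R + 1) * (2 * d) <= (4 * g * M%:R + 1) * (2 * d).
          by rewrite ler_pM2r; lra.
        lra.
      have : (2 * M%:R + 1) * (2 * D) <= (3 * M%:R) * (2 * D) by rewrite ler_pM2r; lra.
      lra.
  exists y; split => // x xs i i' iM i'M; split.
    have [[k kB kE]|far] := natr_absdist i i' B.
      have /Hy /= : (x - (k%:R - B%:R) * h / g, D / g) \in I1 ++ I2.
        by rewrite mem_cat; apply/orP; left; apply/allpairsP; exists (x, k);
          split => //; rewrite mem_iota add0n ltnS.
      rewrite kE ltr_pdivrMr// -{2}(gtr0_norm g0) -normrM.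
      congr (_ < `|_|); by field; rewrite gt_eqF.
    have xW := sW _ xs.
    have yx : `|y - x| <= W by rewrite ler_norml; move: yW xW => /andP[? ?] /andP[? ?]; lra.
    have a1 : 2 * g * W <= `|(i%:R - i'%:R) * h|.
      rewrite normrM (gtr0_norm h0) -hM [h * _]mulrC mulrA ler_pM2r//.
      by move: B2; rewrite -natr1; lra.
    have a2 : `|g * (y - x)| <= g * W by rewrite normrM (gtr0_norm g0) ler_pM2l.
    have := lerB_normD ((i%:R - i'%:R) * h) (g * (y - x)).
    have : D < g * W by apply: lt_le_trans H1; nra.
    lra.
  have [[k kB kE]|far] := natr_absdist i i' M; last first.
    exfalso; move: far; rewrite leNgt => /negP; apply.
    have i0 : 0 <= i%:R :> R by rewrite ler0n.
    have i'0 : 0 <= i'%:R :> R by rewrite ler0n.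
    have i1 : i%:R <= M%:R :> R by rewrite ler_nat ltnW.
    have i1' : i'%:R <= M%:R :> R by rewrite ler_nat ltnW.
    by rewrite ltr_norml; lra.
  have /Hy /= : (x - g * ((k%:R - M%:R) * h), D) \in I1 ++ I2.
    by rewrite mem_cat; apply/orP; right; apply/allpairsP; exists (x, k);
      split => //; rewrite mem_iota add0n ltnS.
  rewrite kE; congr (_ < `|_|); ring.
exists (fun i => i%:R * h), (fun j => f j); split => [i|j|i j i' j'].
- rewrite mulr_ge0 ?(ltW h0)//= -[leRHS]hM [leRHS]mulrC ler_pM2r// ler_nat ltnW//.
- exact: fW.
rewrite -mulrBl.
have [jj'|jj'|jj'] := ltngtP j j'.
- move=> _; have jm : (j < j' < M)%N by rewrite jj' ltn_ord.
  have [h1 h2] := fok _ _ jm i' i (ltn_ord _) (ltn_ord _).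
  have -> : (i%:R - i'%:R) * h + g * (f j - f j') =
    - ((i'%:R - i%:R) * h + g * (f j' - f j)) by ring.
  have -> : g * ((i%:R - i'%:R) * h) + (f j - f j') =
    - (g * ((i'%:R - i%:R) * h) + (f j' - f j)) by ring.
  by rewrite !normrN.
- move=> _; have jm : (j' < j < M)%N by rewrite jj' ltn_ord.
  exact: (fok _ _ jm i i' (ltn_ord _) (ltn_ord _)).
(* With equal second letters the spacing [h] of the regular grid must suffice at both receivers,
   which [8 * D <= g * h <= h] ensures. *)
have -> : j = j' by apply: val_inj.
rewrite subrr mulr0 !addr0 xpair_eqE eqxx andbT => ii'.
have d1 : 1 <= `|i%:R - i'%:R| :> R.
  have := natr_absdist i i' 0 => -[[k]|]; last by rewrite add0r.
  rewrite muln0 leqn0 => /eqP ->; rewrite subrr => /esym/eqP.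
  by rewrite subr_eq0 eqr_nat val_eqE (negbTE ii').
have d2 : h <= `|(i%:R - i'%:R) * h| by rewrite normrM (gtr0_norm h0) ler_peMl// ltW.
split; first lra.
rewrite normrM (gtr0_norm g0); apply: (@lt_le_trans _ _ (g * h)); first lra.
by rewrite ler_pM2l.
Qed.
End separated_grids.

Section alphabets.
Context {R : realType}.

(* Dividing by [g] exchanges the two receivers and turns [(g, D)] into [(1 / g, D / g)]. *)
Lemma sep_grids_strong (M : nat) (g D W : R) : (0 < M)%N -> 1 <= g -> 0 < D -> 0 < W ->
  8 * D * M%:R <= W -> 56 * D * M%:R ^+ 2 <= g * W -> sep_grids M g D W.
Proof.
move=> M0 g1 D0 W0 H1 H2; have g0 : 0 < g by apply: lt_le_trans g1.
have k0 : 0 < g^-1 by rewrite invr_gt0.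
have [||||c1 [c2 [r1 r2 H]]] := @sep_grids_weak R M g^-1 (D / g) W M0 _ _ W0.
- by rewrite k0 invf_le1.
- by rewrite divr_gt0.
- by rewrite -(ler_pM2l g0) [leLHS](_ : _ = 8 * D * M%:R) ?mulVKf ?gt_eqF//; field; rewrite gt_eqF.
- by rewrite -(ler_pM2l g0) [leLHS](_ : _ = 56 * D * M%:R ^+ 2)//; field; rewrite gt_eqF.
exists c1, c2; split => // i j i' j' /H[h1 h2].
have scale x : D / g < `|x| -> D < `|g * x|.
  by move=> h; rewrite normrM (gtr0_norm g0) mulrC -ltr_pdivrMr.
have gn : g != 0 by rewrite gt_eqF.
have {}h1 := scale _ h1; have {}h2 := scale _ h2.
by rewrite mulrDr mulVKf// in h2; rewrite mulrDr mulVKf// in h1.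
Qed.

Definition interference_free (S : finType) (u u' : S -> R) (g T : R) :=
  forall a a' b b', a != a' -> 2 * T < `|u a + g * u' b - (u a' + g * u' b')|.

(* [c1], [c2] carry the common part, [v] the private part: [g * v] stays below [T / 2]. *)
Lemma separated_alphabets (M L : nat) (g T W : R) : 0 < g -> 0 < T ->
  6 * g * L%:R <= 1 -> sep_grids M g (3 * T * (1 + g^-1)) W ->
  exists u1 u2 : 'I_M * 'I_L.+1 -> R,
    [/\ forall a, 0 <= u1 a <= W + T / (2 * g), forall a, 0 <= u2 a <= W + T / (2 * g),
        interference_free u1 u2 g T & interference_free u2 u1 g T].
Proof.
move=> g0 T0 HL [c1 [c2 [r1 r2 H]]].
have k0 : 0 < g^-1 by rewrite invr_gt0.
have gk : g * g^-1 = 1 by rewrite divff// gt_eqF.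
have L1 : L%:R <= g^-1 / 6.
  rewrite -(ler_pM2l (x := 6 * g)); last by rewrite mulr_gt0.
  by rewrite (le_trans HL)// (_ : 6 * g * (g^-1 / 6) = 1)//; field; exact: lt0r_neq0.
have L0 : 0 <= L%:R :> R by rewrite ler0n.
pose v (p : 'I_L.+1) : R := 3 * T * p%:R.
have v0 p : 0 <= v p by rewrite !mulr_ge0// ltW.
have v1 p : v p <= 3 * T * L%:R.
  by rewrite ler_pM2l ?mulr_gt0// ler_nat -ltnS.
have TL : 3 * T * L%:R <= T / 2 * g^-1 by nra.
have TLg : g * (3 * T * L%:R) <= T / 2.
  have -> : T / 2 = g * (T / 2 * g^-1) by rewrite mulrCA gk mulr1.
  by rewrite ler_pM2l.
have dv p q : `|v p - v q| <= 3 * T * L%:R.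
  by rewrite ler_norml; have := v0 p; have := v0 q; have := v1 p; have := v1 q; lra.
have dgv p q : `|g * (v p - v q)| <= T / 2.
  by rewrite normrM (gtr0_norm g0) (le_trans _ TLg)// ler_pM2l.
have kT : T / (2 * g) = T / 2 * g^-1 by field; rewrite gt_eqF.
have range c : 0 <= c <= W -> forall p, 0 <= c + v p <= W + T / (2 * g).
  by move=> /andP[c0 cW] p; rewrite addr_ge0//= kT; have := v1 p; lra.
(* Private parts perturb the output by at most [T / (2 g) + T / 2], far less than the common
   separation [3 T (1 + 1 / g)]. With equal common parts, the spacing [3 T] of [v] minus the
   residual interference [T / 2] still exceeds [2 T]. *)
have core (x y : R) p p' q q' : (3 * T * (1 + g^-1) < `|x + g * y|) \/
    (x = 0 /\ y = 0 /\ p != p') -> 2 * T < `|x + g * y + ((v p - v p') + g * (v q - v q'))|.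
  have h1 := dv p p'; have h2 := dgv q q'.
  case=> [h|[-> [-> pp']]].
    have h3 := lerB_normD (x + g * y) ((v p - v p') + g * (v q - v q')).
    have h4 := ler_normD (v p - v p') (g * (v q - v q')).
    have h5 : 0 < T * g^-1 by rewrite mulr_gt0.
    lra.
  rewrite mulr0 !add0r.
  have d1 : 1 <= `|p%:R - p'%:R| :> R.
    have := @natr_absdist R p p' 0 => -[[k]|]; last by rewrite add0r.
    rewrite muln0 leqn0 => /eqP ->; rewrite subrr => /esym/eqP.
    by rewrite subr_eq0 eqr_nat val_eqE (negbTE pp').
  have d2 : 3 * T <= `|v p - v p'|.
    by rewrite /v -mulrBr normrM gtr0_norm ?mulr_gt0// ler_peMr// mulr_ge0// ltW.
  have h3 := lerB_normD (v p - v p') (g * (v q - v q')).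
  lra.
exists (fun a => c1 a.1 + v a.2), (fun a => c2 a.1 + v a.2); split.
- by move=> a; exact: range.
- by move=> a; exact: range.
- move=> [i p] [i' p'] [j q] [j' q'] /= ne.
  have -> : c1 i + v p + g * (c2 j + v q) - (c1 i' + v p' + g * (c2 j' + v q')) =
    (c1 i - c1 i') + g * (c2 j - c2 j') + ((v p - v p') + g * (v q - v q')) by ring.
  apply: core; have [[ii' jj']|/H[h _]] := eqVneq (i, j) (i', j'); last by left.
  right; rewrite ii' jj' !subrr; split => //; split => //.
  by move: ne; rewrite ii' xpair_eqE eqxx.
- move=> [j q] [j' q'] [i p] [i' p'] /= ne.
  have -> : c2 j + v q + g * (c1 i + v p) - (c2 j' + v q' + g * (c1 i' + v p')) =
    (c2 j - c2 j') + g * (c1 i - c1 i') + ((v q - v q') + g * (v p - v p')) by ring.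
  apply: core; have [[ii' jj']|/H[_ h]] := eqVneq (i, j) (i', j').
    right; rewrite ii' jj' !subrr; split => //; split => //.
    by move: ne; rewrite jj' xpair_eqE eqxx.
  by left; rewrite [X in `|X|]addrC.
Qed.

End alphabets.

(** * Grid sizes as powers of [P] *)

Section parameters.
Context {R : realType}.

Lemma powR_sqr (P e : R) : 0 < P -> (P `^ (e / 2)) ^+ 2 = P `^ e.
Proof. by move=> P0; rewrite -powR_mulrn ?powR_ge0// -powRrM; congr (_ `^ _); field. Qed.

(** The grid lemmas ask for one bound on [M] and one on [M^2], with constants 8 and 56, that is for
    [M] below [Num.min a (Num.sqrt b)]. *)
Lemma min_sqrt_ge (P c a b e1 e2 : R) : 1 <= P -> 0 < c ->
  c / 8 * P `^ e1 <= a -> c / 56 * P `^ e2 <= b ->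
  Num.min (c / 8) (Num.sqrt (c / 56)) * P `^ (Num.min e1 (e2 / 2)) <= Num.min a (Num.sqrt b).
Proof.
move=> P1 c0 Ha Hb; have P0 : 0 < P by apply: lt_le_trans P1.
rewrite le_min; apply/andP; split.
  apply: le_trans Ha; apply: ler_pM; rewrite ?powR_ge0//.
  - by rewrite le_min sqrtr_ge0 divr_ge0// ltW.
  - by rewrite ge_min lexx.
  - by rewrite ler_powR// ge_min lexx.
apply: (@le_trans _ _ (Num.sqrt (c / 56 * P `^ e2))); last exact: ler_wsqrtr.
have -> : Num.sqrt (c / 56 * P `^ e2) = Num.sqrt (c / 56) * P `^ (e2 / 2).
  rewrite -(powR_sqr e2 P0) [LHS]sqrtrM ?divr_ge0 ?(ltW c0)//.
  by rewrite sqrtr_sqr ger0_norm ?powR_ge0.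
apply: ler_pM; rewrite ?powR_ge0//.
- by rewrite le_min sqrtr_ge0 divr_ge0// ltW.
- by rewrite ge_min lexx orbT.
- by rewrite ler_powR// ge_min lexx orbT.
Qed.

Lemma sep_grids_max (g D W x : R) : 0 <= W ->
  (forall M, (0 < M)%N -> M%:R <= x -> sep_grids M g D W) ->
  exists M, [/\ (0 < M)%N, x / 2 <= M%:R & sep_grids M g D W].
Proof.
move=> W0 H; have [x1|x1] := ltP x 1.
  by exists 1%N; split => //; [lra|exact: sep_grids1].
have x0 : 0 <= x by lra.
have /andP[h1 h2] := truncn_itv x0.
have M0 : (0 < Num.truncn x)%N.
  by rewrite lt0n; apply/eqP => z; move: h2; rewrite z; lra.
exists (Num.truncn x); split => //; last exact: H.
have : 1 <= (Num.truncn x)%:R :> R by rewrite ler1n.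
by move: h2; rewrite -natr1; lra.
Qed.

Definition gdof (d : R) : R :=
  Num.min (Num.min (Num.max (1 - d) d) (Num.max (1 - d / 2) (d / 2))) 1.

(** The first summand is the common exponent and [1 - d] the private one. With [D] of order [s / g],
    the condition [8 D M <= g W] allows [M] of order [g^2 P = P ^ (2 d - 1)], and [56 D M^2 <= W]
    allows [M^2] of order [g P = P ^ d]. *)
Lemma gdof_weak d : 0 < d <= 1 -> gdof d <= Num.max 0 (Num.min (2 * d - 1) (d / 2)) + (1 - d).
Proof.
move=> /andP[d0 d1]; rewrite /gdof !minEle !maxEle.
by do ! case: ifPn; rewrite -?ltNge; lra.
Qed.

(** Now [D] is of order [s]: the two grid conditions allow [M] of order [P] and [M^2] of order
    [g P = P ^ d]. *)
Lemma gdof_strong d : 1 <= d -> gdof d <= Num.min 1 (d / 2).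
Proof.
move=> d1; rewrite /gdof !minEle !maxEle.
by do ! case: ifPn; rewrite -?ltNge; lra.
Qed.

Lemma alphabets_exist (al t d : R) : 0 < al -> 0 < t -> 0 < d ->
  exists2 c : R, 0 < c & forall P s, 1 <= P -> 0 < s -> t <= al * P `^ d ->
  exists (S : finType) (u1 u2 : S -> R),
    [/\ (0 < #|S|)%N, c * P `^ gdof d <= #|S|%:R,
        (forall a, 0 <= u1 a <= al * (P * s)) /\ (forall a, 0 <= u2 a <= al * (P * s)),
        interference_free u1 u2 (P `^ (d - 1)) (t * s) &
        interference_free u2 u1 (P `^ (d - 1)) (t * s)].
Proof.
move=> al0 t0 d0.
(* Chosen so that [c1 * P * (6 * T) = W], where [6 * T] bounds [D * Num.min 1 g]. *)
pose c1 := al / (12 * t).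
have c10 : 0 < c1 by rewrite divr_gt0// mulr_gt0.
pose c2 := Num.min (c1 / 8) (Num.sqrt (c1 / 56)).
have c20 : 0 < c2 by rewrite lt_min sqrtr_gt0; apply/andP; split; exact: divr_gt0.
(* The half comes from rounding [M] down, the minimum with 1 from the one-point grid, and the 6 from
   [L.+1 > g^-1 / 6]. *)
pose c := Num.min 1 (c2 / 2) / 6.
have c0 : 0 < c by rewrite divr_gt0// lt_min ltr01 andTb; exact: divr_gt0.
exists c => // P s P1 s0 Pt.
have P0 : 0 < P by apply: lt_le_trans P1.
set g := P `^ (d - 1).
have g0 : 0 < g by rewrite powR_gt0.
have gn : g != 0 by rewrite gt_eqF.
have k0 : 0 < g^-1 by rewrite invr_gt0.
have pP (e : R) : 0 < P `^ e by rewrite powR_gt0.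
have PD (e e' : R) : P `^ (e + e') = P `^ e * P `^ e' by rewrite powRD ?(gt_eqF P0) ?implybT.
have gP : P * g = P `^ d by rewrite -{1}(powRr1 (ltW P0)) -PD; congr (_ `^ _); ring.
pose T := t * s; have T0 : 0 < T by rewrite mulr_gt0.
(* Half of the range [al * A] is for the common letters. The private ones extend to [T / (2 * g)],
   which fits the other half when [t <= al * P ^ d]. *)
pose W := al * (P * s) / 2; have W0 : 0 < W by rewrite divr_gt0// !mulr_gt0.
pose D := 3 * T * (1 + g^-1); have D0 : 0 < D by rewrite !mulr_gt0// addr_gt0.
have D8 : 0 < 8 * D by exact: mulr_gt0.
have D56 : 0 < 56 * D by exact: mulr_gt0.
have TW : W + T / (2 * g) <= al * (P * s).
  have : T / g <= al * (P * s).
    rewrite ler_pdivrMr//; have -> : al * (P * s) * g = al * (P * g) * s by ring.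
    by rewrite gP ler_pM2r.
  have -> : T / (2 * g) = T / g / 2 by field.
  by rewrite /W; lra.
pose L := Num.truncn (g^-1 / 6).
have kd : g^-1 = P `^ (1 - d) by rewrite /g -powRN; congr (_ `^ _); ring.
have /andP[L1 L2] : L%:R <= g^-1 / 6 < L.+1%:R by apply: truncn_itv; rewrite divr_ge0// ltW.
have LH : 6 * g * L%:R <= 1.
  apply: (@le_trans _ _ (6 * g * (g^-1 / 6))); first by rewrite ler_pM2l// mulr_gt0.
  by rewrite [leLHS](_ : _ = 1)//; field.
suff [M [M0 MP sepM]] : exists M,
    [/\ (0 < M)%N, c * P `^ gdof d <= M%:R * L.+1%:R & sep_grids M g D W].
  have [u1 [u2 [r1 r2 s1 s2]]] := separated_alphabets g0 T0 LH sepM.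
  exists ('I_M * 'I_L.+1)%type, u1, u2; rewrite card_prod !card_ord natrM; split => //.
  - by rewrite muln_gt0 M0.
  - by split=> a; [have /andP[-> /= h] := r1 a|have /andP[-> /= h] := r2 a]; exact: le_trans h TW.
have fin x e : c2 * P `^ e <= x -> gdof d <= Num.max 0 e + (1 - d) ->
    (forall M, (0 < M)%N -> M%:R <= x -> sep_grids M g D W) ->
    exists M, [/\ (0 < M)%N, c * P `^ gdof d <= M%:R * L.+1%:R & sep_grids M g D W].
  move=> xe de Hx; have [M [M0 Mx sM]] := sep_grids_max (ltW W0) Hx.
  exists M; split => //.
  have M1 : 1 <= M%:R :> R by rewrite ler1n.
  have A : Num.min 1 (c2 / 2) * P `^ (Num.max 0 e) <= M%:R.
    rewrite maxEle; case: ifP => _.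
      apply: (@le_trans _ _ (c2 / 2 * P `^ e)); last lra.
      by rewrite ler_pM2r// ge_min lexx orbT.
    by rewrite powRr0 mulr1 ge_min (le_trans _ M1) ?lexx.
  apply: (@le_trans _ _ (c * P `^ (Num.max 0 e + (1 - d)))).
    by rewrite ler_pM2l// ler_powR.
  rewrite PD -kd /c.
  have -> : Num.min 1 (c2 / 2) / 6 * (P `^ Num.max 0 e * g^-1) =
    Num.min 1 (c2 / 2) * P `^ (Num.max 0 e) * (g^-1 / 6) by field.
  apply: ler_pM => //; last exact: ltW.
    by rewrite mulr_ge0 ?powR_ge0// le_min ler01 divr_ge0// ltW.
  by rewrite divr_ge0// ltW.
have [d1|d1] := leP d 1.
  have g1 : g <= 1 by rewrite -(powRr0 P) ler_powR//; lra.
  have D2 : D * g <= 6 * T.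
    rewrite /D; have -> : 3 * T * (1 + g^-1) * g = 3 * T * (1 + g) by field.
    have -> : 6 * T = 3 * T * 2 by ring.
    by rewrite ler_pM2l ?mulr_gt0//; lra.
  have WD : c1 * (P * g) * D <= W.
    have -> : c1 * (P * g) * D = c1 * P * (D * g) by ring.
    have -> : W = c1 * P * (6 * T) by rewrite /W /c1 /T; field; rewrite gt_eqF.
    by rewrite ler_pM2l// mulr_gt0.
  apply: (fin (Num.min (g * W / (8 * D)) (Num.sqrt (W / (56 * D)))) (Num.min (2 * d - 1) (d / 2))).
  - apply: min_sqrt_ge => //.
      rewrite ler_pdivlMr//.
      have -> : P `^ (2 * d - 1) = P * g * g.
        by rewrite gP -PD; congr (_ `^ _); ring.
      have -> : c1 / 8 * (P * g * g) * (8 * D) = g * (c1 * (P * g) * D) by field.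
      by rewrite ler_pM2l.
    rewrite ler_pdivlMr// -gP.
    by have -> : c1 / 56 * (P * g) * (56 * D) = c1 * (P * g) * D by field.
  - by apply: gdof_weak; rewrite d0.
  - move=> M M0; rewrite le_min => /andP[h1 h2].
    apply: sep_grids_weak; rewrite ?g0//.
      by move: h1; rewrite ler_pdivlMr//; lra.
    have : M%:R ^+ 2 <= W / (56 * D).
      rewrite -[leRHS]sqr_sqrtr; last exact: divr_ge0 (ltW W0) (ltW D56).
      by rewrite ler_pXn2r ?nnegrE ?sqrtr_ge0 ?ler0n.
    by rewrite ler_pdivlMr//; lra.
have g1 : 1 <= g by rewrite -(powRr0 P) ler_powR//; lra.
have D2 : D <= 6 * T.
  have -> : 6 * T = 3 * T * 2 by ring.
  rewrite /D ler_pM2l ?mulr_gt0//.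
  have : g^-1 <= 1 by rewrite invf_le1.
  lra.
have WD : c1 * P * D <= W.
  have -> : W = c1 * P * (6 * T) by rewrite /W /c1 /T; field; rewrite gt_eqF.
  by rewrite ler_pM2l// mulr_gt0.
pose x := Num.min (W / (8 * D)) (Num.sqrt (g * W / (56 * D))).
have xP : c2 * P `^ (Num.min 1 (d / 2)) <= x.
  apply: min_sqrt_ge => //.
    rewrite powRr1 ?(ltW P0)// ler_pdivlMr//.
    by have -> : c1 / 8 * P * (8 * D) = c1 * P * D by field.
  rewrite ler_pdivlMr// -gP.
  have -> : c1 / 56 * (P * g) * (56 * D) = g * (c1 * P * D) by field.
  by rewrite ler_pM2l.
have Hx M : (0 < M)%N -> M%:R <= x -> sep_grids M g D W.
  move=> M0; rewrite le_min => /andP[h1 h2].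
  apply: sep_grids_strong => //.
    by move: h1; rewrite ler_pdivlMr//; lra.
  have : M%:R ^+ 2 <= g * W / (56 * D).
    rewrite -[leRHS]sqr_sqrtr; last exact: divr_ge0 (mulr_ge0 (ltW g0) (ltW W0)) (ltW D56).
    by rewrite ler_pXn2r ?nnegrE ?sqrtr_ge0 ?ler0n.
  by rewrite ler_pdivlMr//; lra.
have [M [M0 Mx sM]] := sep_grids_max (ltW W0) Hx.
exists M; split => //.
have M1 : 1 <= M%:R :> R by rewrite ler1n.
apply: (@le_trans _ _ M%:R); last by rewrite ler_peMr ?ler1n// (le_trans ler01).
apply: (@le_trans _ _ (c2 / 2 * P `^ (Num.min 1 (d / 2)))); last lra.
apply: ler_pM; rewrite ?powR_ge0 ?(ltW c0)//.
  have : Num.min 1 (c2 / 2) <= c2 / 2 by rewrite ge_min lexx orbT.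
  by rewrite /c; lra.
by rewrite ler_powR//; apply: gdof_strong; exact: ltW.
Qed.

End parameters.

(** * The limit *)

Section asymptotics.
Context {R : realType}.

Lemma ln2_gt0 : 0 < ln 2 :> R. Proof. by rewrite ln_gt0// ltr1n. Qed.

Lemma log2M (x y : R) : 0 < x -> 0 < y -> log2 (x * y) = log2 x + log2 y.
Proof. by move=> x0 y0; rewrite /log2 lnM ?posrE// mulrDl. Qed.

Lemma log2_powR (x y : R) : log2 (x `^ y) = y * log2 x.
Proof. by rewrite /log2 ln_powR mulrA. Qed.

Lemma ler_log2 (x y : R) : 0 < x -> x <= y -> log2 x <= log2 y.
Proof.
move=> x0 xy; rewrite /log2 ler_pM2r ?invr_gt0 ?ln2_gt0// ler_ln// posrE//.
exact: lt_le_trans xy.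
Qed.

(** * Upper bound on the achievable sum rates *)

Section converse.
Variables (al d P s : R).
Hypothesis P1 : 1 <= P.
Hypothesis s0 : 0 < s.
Local Notation g := (P `^ (d - 1)).

Let P0 : 0 < P. Proof. exact: lt_le_trans P1. Qed.
Let pP (e : R) : 0 < P `^ e. Proof. by rewrite powR_gt0. Qed.
Let PD (e e' : R) : P `^ e * P `^ e' = P `^ (e + e').
Proof. by rewrite powRD ?(gt_eqF P0) ?implybT. Qed.
Let Pk : g^-1 = P `^ (1 - d). Proof. by rewrite -powRN; congr (_ `^ _); ring. Qed.
Let gP : g * P = P `^ d.
Proof. by rewrite -{2}(powRr1 (ltW P0)) PD; congr (_ `^ _); ring. Qed.
Let PsP : P * s / s = P. Proof. by rewrite mulfK// gt_eqF. Qed.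

(** 36 is the square of the 6 in the genie bound; the other two bounds fit under it with 16. *)
Let rate_le (L1 L2 e : R) r : 0 < L1 -> 0 < L2 -> L1 * L2 <= 36 * P `^ (2 * e) ->
  (forall n M1 M2 (c : Defs.code R n M1 M2) e1 e2, (0 < M1)%N -> (0 < M2)%N ->
     valid_code (P * s) al al c -> e1 + e2 <= 1 ->
     (err1 1 g s c <= e1%:E)%E -> (err2 1 g s c <= e2%:E)%E ->
     (M1 * M2)%:R * (1 - e1 - e2) ^+ 2 <= (expR 1 * L1 * L2) ^+ n) ->
  achievable 1 g g 1 al al (P * s) s r ->
  r.1 + r.2 <= log2 (expR 1 * 36) + 2 * e * log2 P.
Proof.
move=> L10 L20 HL Hc Hr; rewrite -log2_powR -log2M ?mulr_gt0 ?expR_gt0//.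
apply: (rate_bound _ _ Hr); first by rewrite !mulr_gt0 ?expR_gt0.
move=> n M1 M2 c e1 e2 M10 M20 vc e12 h1 h2.
apply: (le_trans (Hc n M1 M2 c e1 e2 M10 M20 vc e12 h1 h2)).
rewrite lerXn2r ?nnegrE ?mulr_ge0 ?expR_ge0 ?(ltW L10) ?(ltW L20) ?powR_ge0//.
by rewrite -!mulrA ler_pM2l ?expR_gt0// (le_trans HL).
Qed.

Let Ps0 : 0 <= P * s. Proof. by rewrite mulr_ge0// ltW. Qed.

Lemma sum_rate_le r : achievable 1 g g 1 al al (P * s) s r ->
  r.1 + r.2 <= log2 (expR 1 * 36) + 2 * gdof d * log2 P.
Proof.
move=> Hr; have PP := P1; have Pp := P0; have sp := s0.
have k0 : 0 < g^-1 by rewrite invr_gt0.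
have H1 : r.1 + r.2 <= log2 (expR 1 * 36) + 2 * 1 * log2 P.
  apply: (@rate_le (2 + 2 * P) (2 + 2 * P) 1 r) => //; [lra|lra| |].
    by rewrite mulr1 powR_mulrn ?(ltW P0)//; nra.
  move=> n M1 M2 c e1 e2 M10 M20 vc e12 h1 h2.
  by apply: (code_single_user_bound s0 M10 M20 vc e12 h1 h2); nra.
have H2 : r.1 + r.2 <= log2 (expR 1 * 36) + 2 * (Num.max (1 - d / 2) (d / 2)) * log2 P.
  have g10 : 0 < 1 + g by rewrite addr_gt0.
  apply: (@rate_le (2 * (1 + g^-1)) (2 + P * (1 + g))) => //.
  - by rewrite mulr_gt0// addr_gt0.
  - by rewrite addr_gt0// mulr_gt0.
  - have [d1|d1] := leP d 1.
      have gl : g <= 1 by rewrite -[leRHS](powRr0 P) ler_powR//; lra.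
      have kl : 1 <= g^-1 by rewrite Pk -[leLHS](powRr0 P) ler_powR//; lra.
      have -> : Num.max (1 - d / 2) (d / 2) = 1 - d / 2 by rewrite maxEle; case: ifP => //; lra.
      have -> : P `^ (2 * (1 - d / 2)) = g^-1 * P.
        by rewrite Pk -{3}(powRr1 (ltW P0)) PD; congr (_ `^ _); field.
      have e1 : 2 * (1 + g^-1) <= 4 * g^-1 by lra.
      have e2 : 2 + P * (1 + g) <= 4 * P by nra.
      apply: (@le_trans _ _ ((4 * g^-1) * (4 * P))).
        apply: ler_pM => //; first by rewrite mulr_ge0// addr_ge0// ltW.
        by rewrite addr_ge0// mulr_ge0// ltW.
      have : 0 < g^-1 * P by rewrite mulr_gt0.
      lra.
    have gl : 1 <= g by rewrite -[leLHS](powRr0 P) ler_powR//; lra.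
    have kl : g^-1 <= 1 by rewrite Pk -[leRHS](powRr0 P) ler_powR//; lra.
    have -> : Num.max (1 - d / 2) (d / 2) = d / 2 by rewrite maxEle; case: ifP => //; lra.
    have -> : P `^ (2 * (d / 2)) = g * P by rewrite gP; congr (_ `^ _); field.
    have e1 : 2 * (1 + g^-1) <= 4 by lra.
    have e2 : 2 + P * (1 + g) <= 4 * (g * P) by nra.
    apply: (@le_trans _ _ (4 * (4 * (g * P)))).
      by apply: ler_pM => //; [rewrite mulr_ge0// addr_ge0// ltW|rewrite addr_ge0// mulr_ge0// ltW].
    have : 0 < g * P by rewrite mulr_gt0.
    lra.
  - move=> n M1 M2 c e1 e2 M10 M20 vc e12 h1 h2.
    apply: (code_z_bound s0 (pP _) M10 M20 vc e12 h1 h2) => //.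
    by rewrite mulrAC PsP.
have H3 : r.1 + r.2 <= log2 (expR 1 * 36) + 2 * (Num.max (1 - d) d) * log2 P.
  set m := Num.max (1 - d) d.
  have q0 : 1 <= P `^ m.
    by rewrite -[leLHS](powRr0 P) ler_powR// /m maxEle; case: ifP; rewrite -?ltNge; lra.
  have q1 : g^-1 <= P `^ m by rewrite Pk ler_powR// le_max lexx.
  have q2 : g * P <= P `^ m by rewrite gP ler_powR// le_max lexx orbT.
  have LL : 2 * (1 + g^-1) + 2 * (g * P) <= 6 * P `^ m by lra.
  have L0 : 0 < 2 * (1 + g^-1) + 2 * (g * P).
    by rewrite addr_gt0// mulr_gt0// ?addr_gt0// mulr_gt0.
  apply: (@rate_le (2 * (1 + g^-1) + 2 * (g * P)) (2 * (1 + g^-1) + 2 * (g * P))) => //.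
  - have -> : P `^ (2 * m) = P `^ m * P `^ m by rewrite PD; congr (_ `^ _); ring.
    apply: (@le_trans _ _ ((6 * P `^ m) * (6 * P `^ m))); last lra.
    by apply: ler_pM => //; exact: ltW.
  - move=> n M1 M2 c e1 e2 M10 M20 vc e12 h1 h2.
    apply: (code_genie_bound s0 (pP _) M10 M20 vc e12 h1 h2) => //.
    by rewrite -(mulrA (2 * g)) PsP mulrA.
by rewrite /gdof !minEle; case: ifP => _ //; case: ifP.
Qed.

End converse.

Lemma achievable_rate (al d ep : R) : 0 < al <= 1 -> 0 < d -> 0 < ep -> 2 * ep <= 1 ->
  exists C B : R, forall P s, B <= P -> 1 <= P -> 0 < s ->
    exists2 r, achievable 1 (P `^ (d - 1)) (P `^ (d - 1)) 1 al al (P * s) s r &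
      2 * (1 - 2 * ep) * gdof d * log2 P - C <= r.1 + r.2.
Proof.
move=> /andP[al0 al1] d0 ep0 ep2.
pose eta : R := 2 `^ ep - 1.
have eta0 : 0 < eta by rewrite subr_gt0 /powR pnatr_eq0 expR_gt1 mulr_gt0 ?ln2_gt0.
(* From [expR y > y] for [y = 3 / 8 * t ^+ 2 >= x], the tail term is below [2 / x = eta]. *)
pose x := 2 / eta; have x0 : 0 < x by rewrite divr_gt0.
pose t := 1 + 8 / 3 * x.
have t1 : 1 <= t by rewrite lerDl mulr_ge0// ltW.
have tail : 1 + 2 * expR (- (3 / 8 * t ^+ 2)) < 2 `^ ep.
  have tx : x <= 3 / 8 * t ^+ 2 by rewrite /t; nra.
  have e1 : expR (- (3 / 8 * t ^+ 2)) < x^-1.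
    rewrite expRN ltf_pV2 ?posrE ?expR_gt0//.
    by apply: (lt_le_trans _ (expR_ge1Dx _)); lra.
  have e2 : 2 * x^-1 = eta by rewrite /x invf_div mulrC divfK.
  have : 2 * expR (- (3 / 8 * t ^+ 2)) < eta by rewrite -e2 ltr_pM2l.
  by rewrite /eta; lra.
have t0 : 0 < t by lra.
have [c c0 Hc] := alphabets_exist al0 t0 d0.
(* For each of the two users, [log2 c] comes from the alphabet size and 1 from the ball count. The
   threshold on [P] is the condition [t <= al * P ^ d] solved for [P]. *)
exists (2 * (`|log2 c| + 1)), ((t / al) `^ d^-1) => P s BP P1 s0.
have P0 : 0 < P by lra.
have Pt : t <= al * P `^ d.
  rewrite mulrC -ler_pdivrMr//.
  have td : 0 <= t / al by rewrite divr_ge0 ?ltW.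
  have -> : t / al = ((t / al) `^ d^-1) `^ d by rewrite -powRrM mulVf ?gt_eqF// powRr1.
  by rewrite ge0_ler_powR ?nnegrE ?powR_ge0 ?(ltW d0) ?(ltW P0).
have [S [u1 [u2 [S0 qS [r1 r2] s1 s2]]]] := Hc P s P1 s0 Pt.
have Ps0 : 0 <= P * s by rewrite mulr_ge0 ?ltW.
have Ha := achievable_separated s0 (ltW t0) ep0 S0 Ps0 al1 tail r1 r2 s1 s2.
eexists; first exact: Ha.
rewrite /=.
have Pg : 0 < P `^ gdof d by rewrite powR_gt0.
have lq : log2 c + gdof d * log2 P <= log2 (#|S|%:R : R).
  by rewrite -log2_powR -log2M//; apply: ler_log2 => //; rewrite mulr_gt0.
have n1 := ler_norm (- log2 c); rewrite normrN in n1.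
have n0 := normr_ge0 (log2 c).
have lb : (1 - 2 * ep) * (log2 c + gdof d * log2 P) <= (1 - 2 * ep) * log2 (#|S|%:R : R).
  by rewrite ler_wpM2l//; lra.
have nn : - `|log2 c| <= (1 - 2 * ep) * log2 c by nra.
lra.
Qed.

End asymptotics.

Theorem theorem7 (R : realType) (alpha delta : R) :
  0 < alpha <= 1 -> 0 < delta ->
  forall A_ sigma_ : nat -> R,
    (forall k, 0 < A_ k) -> (forall k, 0 < sigma_ k) ->
    (fun k => A_ k / sigma_ k) @ \oo --> +oo ->
    (fun k => Csum 1 ((A_ k / sigma_ k) `^ (delta - 1))
                     ((A_ k / sigma_ k) `^ (delta - 1)) 1
                   alpha alpha (A_ k) (sigma_ k)
              / (2 * log2 (A_ k / sigma_ k)))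
      @ \oo --> Num.min (Num.min (Num.max (1 - delta) delta)
                                 (Num.max (1 - delta / 2) (delta / 2))) 1.
Proof.
move=> al01 d0 A_ sigma_ A0 s0 Poo; rewrite -/(gdof delta).
apply/cvgrPdist_le => e e0.
(* The sum rate may deviate by [2 * e * log2 P]. The factor [1 - 2 * ep] uses at most half of this,
   and [N] below is so large that the additive constants fit in the other half. *)
pose ep := Num.min (1 / 2) (e / 4).
have ep0 : 0 < ep by rewrite lt_min !divr_gt0.
have ep2 : 2 * ep <= 1.
  have : ep <= 1 / 2 by rewrite ge_min lexx.
  lra.
have epe : ep <= e / 4 by rewrite ge_min lexx orbT.
have [C [B HC]] := achievable_rate al01 d0 ep0 ep2.
pose C0 : R := log2 (expR 1 * 36).
pose N : R := 1 + `|C| / e + `|C0| / e.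
have N1 : 1 <= N by rewrite /N -addrA lerDl addr_ge0// divr_ge0// ltW.
have big : \forall k \near \oo, Num.max B (2 `^ N) <= A_ k / sigma_ k.
  by move/cvgryPge: Poo; apply.
near=> k.
have : Num.max B (2 `^ N) <= A_ k / sigma_ k by near: k.
set P := A_ k / sigma_ k; rewrite ge_max => /andP[BP NP].
have P0 : 0 < P by rewrite divr_gt0.
have NlP : N <= log2 P by rewrite -le_log2.
have P1 : 1 <= P.
  by apply: le_trans NP; rewrite -[leLHS](powRr0 2) ler_powR ?ler1n//; lra.
(* The rate bounds are uniform in the noise level, so [A_] and [sigma_] may vary in any way as long
   as their ratio diverges. *)
have AE : A_ k = P * sigma_ k by rewrite /P divfK// gt_eqF.
rewrite AE; set l := log2 P in NlP *.
have l0 : 0 < l by lra.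
have [r rA rL] := HC P (sigma_ k) BP P1 (s0 k).
have /andP[lo up] := Csum_bounds (fun r => @sum_rate_le R alpha delta P (sigma_ k) P1 (s0 k) r)
  (ex_intro2 _ _ r rA erefl).
set Cs := Csum _ _ _ _ _ _ _ _ in lo up *.
have eN x : `|x| / e <= l -> `|x| <= e * l by rewrite ler_pdivrMr// mulrC.
have q1 : 0 <= `|C| / e by rewrite divr_ge0// ltW.
have q2 : 0 <= `|C0| / e by rewrite divr_ge0// ltW.
have c1 : `|C| <= e * l by apply: eN; apply: le_trans NlP; rewrite /N; lra.
have c2 : `|C0| <= e * l by apply: eN; apply: le_trans NlP; rewrite /N; lra.
have G1 : gdof delta <= 1 by rewrite /gdof ge_min lexx orbT.
have C1 := ler_norm C; have C2 := ler_norm C0.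
have l2 : 0 < 2 * l by rewrite mulr_gt0.
have pl : ep * l <= e / 4 * l by rewrite ler_pM2r.
have gl : gdof delta * (ep * l) <= ep * l by rewrite ler_piMl// mulr_ge0// ltW.
rewrite -/l in rL up; rewrite -/C0 in up.
have el : 0 < e * l by rewrite mulr_gt0.
have lo2 : 2 * l * (gdof delta - e) <= Cs by lra.
have up2 : Cs <= 2 * l * (gdof delta + e) by lra.
rewrite distrC ler_distl; apply/andP; split.
  by rewrite ler_pdivlMr// mulrC.
by rewrite ler_pdivrMr// mulrC.
Unshelve. all: by end_near.
Qed.
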